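(* For every $k>0$ and $n\ge1$, let $\mathcal H_k^n$ be the $n$-dimensional hyperbolic space of curvature $-k^2$. Under the change of variables $x_i=\exp_z(ru_i)$, $0\le i\le n$, with $r>0$, $z\in\mathcal H_k^n$ and $u_0,\dots,u_n$ unit vectors of $T_z\mathcal H_k^n$, the following equality of measures is satisfied: $$\mathrm{dvol}^{(\mathcal H_k^n)}(x_0)\cdots\mathrm{dvol}^{(\mathcal H_k^n)}(x_n)=n!\,\Delta_n(u_0,\dots,u_n)\left(\frac{\sinh(kr)}{k}\right)^{n^2-1}\mathrm dr\,\mathrm{dvol}^{(\mathcal H_k^n)}(z)\,\mathrm{dvol}^{(\mathcal S^{n-1})}(u_0)\cdots\mathrm{dvol}^{(\mathcal S^{n-1})}(u_n).$$
   Context: $\mathrm{vol}^{(\mathcal H_k^n)}$ is the Riemannian measure of $\mathcal H_k^n$; $\mathrm{vol}^{(\mathcal S^{n-1})}$ is the spherical Lebesgue measure on the unit sphere $\mathcal S^{n-1}$, identified with the unit sphere of $T_z\mathcal H_k^n$ (counting measure if $n=1$). $\Delta_n(u_0,\dots,u_n)$ is the $n$-dimensional Lebesgue measure, in the Euclidean space $T_z\mathcal H_k^n$, of the simplex with vertices $u_0,\dots,u_n$. The equality of measures means that the Jacobian determinant of the map $(r,z,u_0,\dots,u_n)\mapsto(x_0,\dots,x_n)$, relative to the measure $\mathrm dr\,\mathrm{dvol}^{(\mathcal H_k^n)}(z)\prod_{i=0}^n\mathrm{dvol}^{(\mathcal S^{n-1})}(u_i)$ on the source and the product Riemannian measure on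 $(\mathcal H_k^n)^{n+1}$, has absolute value $n!\,\Delta_n(u_0,\dots,u_n)\left(\frac{\sinh(kr)}{k}\right)^{n^2-1}$ at every $(r,z,u_0,\dots,u_n)$. *)

(* Defs.v *)
From HB Require Import structures.
From mathcomp Require Import all_boot all_order all_algebra.
From mathcomp Require Import all_classical all_reals all_analysis.

Set Implicit Arguments.
Unset Strict Implicit.
Unset Printing Implicit Defensive.

Import Order.TTheory GRing.Theory Num.Theory.
Import numFieldNormedType.Exports.

Local Open Scope classical_set_scope.
Local Open Scope ring_scope.

(* In the first group of definitions a manifold is a submanifold M of a normed
   space W, with the Riemannian metric induced by a symmetric bilinear form g
   on W (possibly indefinite on W, but positive definite on tangent spaces).  *)

Definition curve_at (R : realType) (W : normedModType R) (M : set W)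
    (p v : W) (c : R -> W) : Prop :=
  [/\ \forall t \near (0 : R), M (c t), c 0 = p & is_derive (0 : R) 1 c v].

Definition tangent (R : realType) (W : normedModType R) (M : set W) (p : W) :
    set W :=
  [set v | exists c : R -> W, curve_at M p v c].

Definition is_orthonormal_basis (R : realType) (W : normedModType R)
    (g : W -> W -> R) (M : set W) (p : W) (N : nat) (e : 'I_N -> W) : Prop :=
  [/\ forall i, tangent M p (e i),
      forall i j, g (e i) (e j) = (i == j)%:R &
      forall v, tangent M p v -> exists a : 'I_N -> R, v = \sum_i a i *: e i].

(* The differential at p of a map defined on M sends v to w. *)
Definition is_differential (R : realType) (W W' : normedModType R)
    (M : set W) (F : W -> W') (p v : W) (w : W') : Prop :=
  forall c : R -> W, curve_at M p v c -> is_derive (0 : R) 1 (F \o c) w.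

(* J is the Jacobian determinant at p of F : M -> M', relative to the
   Riemannian measures of the N-dimensional manifolds M and M': the determinant
   of the differential in orthonormal bases of the two tangent spaces. It is
   defined up to sign. *)
Definition is_jacobian_det (R : realType) (W W' : normedModType R) (N : nat)
    (g : W -> W -> R) (M : set W) (g' : W' -> W' -> R) (M' : set W')
    (F : W -> W') (p : W) (J : R) : Prop :=
  exists (e : 'I_N -> W) (e' : 'I_N -> W') (A : 'M[R]_N),
    [/\ is_orthonormal_basis g M p e,
        is_orthonormal_basis g' M' (F p) e',
        forall i, is_differential M F p (e i) (\sum_j A i j *: e' j) &
        J = \det A].

(* The Levi-Civita derivative of the velocity is the tangential part of the
   acceleration, so c is a geodesic when its acceleration is normal to M. *)
Definition is_geodesic (R : realType) (W : normedModType R)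
    (g : W -> W -> R) (M : set W) (c : R -> W) : Prop :=
  [/\ forall t, M (c t),
      forall t, derivable c t 1,
      forall t, derivable (derive1 c) t 1 &
      forall t w, tangent M (c t) w -> g (derive1 (derive1 c) t) w = 0].

(* The default value p is taken when there is no geodesic defined on R that
   starts at p with velocity v. *)
Definition exp_map (R : realType) (W : normedModType R)
    (g : W -> W -> R) (M : set W) (p v : W) : W :=
  xget p [set x | exists c : R -> W,
    [/\ is_geodesic g M c, c 0 = p, derive1 c 0 = v & c 1 = x]].

Definition dot (R : realType) (n : nat) (x y : 'rV[R]_n) : R :=
  \sum_(i < n) x 0 i * y 0 i.

Definition unit_sphere (R : realType) (n : nat) : set 'rV[R]_n :=
  [set x | dot x x = 1].

Definition mink (R : realType) (n : nat) (x y : 'rV[R]_n.+1) : R :=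
  - (x 0 ord0 * y 0 ord0)
  + \sum_(i < n) x 0 (lift ord0 i) * y 0 (lift ord0 i).

(* Hyperboloid model of the n-dimensional hyperbolic space of curvature
   - k ^+ 2; its Riemannian metric is induced by [mink]. *)
Definition hyperbolic (R : realType) (k : R) (n : nat) : set 'rV[R]_n.+1 :=
  [set x | mink x x = - (k ^- 2) /\ 0 < x 0 ord0].

(* Powers of a manifold, points and tangent vectors being stored as the rows of
   a matrix, with the product metric. *)
Definition pow_set (R : realType) (m n : nat) (M : set 'rV[R]_n) :
    set 'M[R]_(m, n) :=
  [set X | forall i, M (row i X)].

Definition pow_form (R : realType) (m n : nat) (g : 'rV[R]_n -> 'rV[R]_n -> R)
    (X Y : 'M[R]_(m, n)) : R :=
  \sum_(i < m) g (row i X) (row i Y).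

(* The source manifold ]0, +oo[ x H_k^n x (S^(n-1))^(n+1), with the product
   metric, whose Riemannian measure is dr dvol(z) dvol(u_0) ... dvol(u_n).
   For n = 1 the sphere is 0-dimensional and its Riemannian measure is the
   counting measure. *)
Definition source_type (R : realType) (n : nat) : normedModType R :=
  (R * 'rV[R]_n.+1 * 'M[R]_(n.+1, n))%type.

Definition source (R : realType) (k : R) (n : nat) : set (source_type R n) :=
  [set p | [/\ 0 < p.1.1, hyperbolic k p.1.2 &
               pow_set (unit_sphere (R := R) (n := n)) p.2]].

Definition source_form (R : realType) (n : nat) (v w : source_type R n) : R :=
  v.1.1 * w.1.1 + mink v.1.2 w.1.2
  + pow_form (dot (R := R) (n := n)) v.2 w.2.

(* The rows of E z form an orthonormal basis of the tangent space at z that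
   varies differentiably with z. Then t |-> t *m E z identifies the Euclidean
   space R^n with the tangent space at z, and S^(n-1) with its unit sphere. *)
Definition is_orthonormal_frame (R : realType) (k : R) (n : nat)
    (E : 'rV[R]_n.+1 -> 'M[R]_(n, n.+1)) : Prop :=
  forall z, hyperbolic k z ->
    differentiable E z /\
    is_orthonormal_basis (mink (R := R) (n := n)) (hyperbolic k (n := n)) z
      (fun i => row i (E z)).

(* (r, z, u_0, ..., u_n) |-> (exp_z (r u_0), ..., exp_z (r u_n)), where
   u_i = t_i *m E z with t_0, ..., t_n in S^(n-1). *)
Definition change_var (R : realType) (k : R) (n : nat)
    (E : 'rV[R]_n.+1 -> 'M[R]_(n, n.+1)) (p : source_type R n) :
    'M[R]_n.+1 :=
  \matrix_(i < n.+1)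
    exp_map (mink (R := R) (n := n)) (hyperbolic k (n := n)) p.1.2
      (p.1.1 *: row i (p.2 *m E p.1.2)).

(* n-dimensional Lebesgue measure of a Borel set, as the n-fold product of the
   one-dimensional one (iterated integral of the measures of the sections). *)
Fixpoint lebesgue_rV (R : realType) (n : nat) : set 'rV[R]_n -> \bar R :=
  match n with
  | 0 => fun A => (\1_A 0)%:E
  | m.+1 => fun A =>
      (\int[lebesgue_measure]_(x in setT)
         lebesgue_rV [set y : 'rV[R]_m | A (row_mx (x%:M : 'rV_1) y)])%E
  end.

Definition simplex (R : realType) (m n : nat) (u : 'M[R]_(m, n)) :
    set 'rV[R]_n :=
  [set x | exists a : 'I_m -> R,
    [/\ forall i, 0 <= a i, \sum_i a i = 1 & x = \sum_i a i *: row i u]].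

(* Lebesgue measure, in the Euclidean space spanned by the orthonormal rows of
   e, of the simplex whose vertices are the rows of u. *)
Definition simplex_vol (R : realType) (m n p : nat) (e : 'M[R]_(n, p))
    (u : 'M[R]_(m, p)) : \bar R :=
  lebesgue_rV [set a : 'rV[R]_n | simplex u (a *m e)].

Definition sinh (R : realType) (x : R) : R := (expR x - expR (- x)) / 2.

(* Main.v *)
Require Import Defs.
From HB Require Import structures.
From mathcomp Require Import all_boot all_order all_algebra.
From mathcomp Require Import all_classical all_reals all_analysis.
From mathcomp Require Import perm measurable_realfun.
From mathcomp Require Import ring lra.

Set Implicit Arguments.
Unset Strict Implicit.
Unset Printing Implicit Defensive.

Import Order.TTheory GRing.Theory Num.Theory.
Import numFieldNormedType.Exports.

Local Open Scope classical_set_scope.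
Local Open Scope ring_scope.

(** Write S = sinh (k r), C = cosh (k r), s = S / k and u_i = t_i *m E z. In the
hyperboloid model exp_z (r u_i) = C z + s u_i, so the change of variables is
explicit and its Jacobian is a finite determinant.

The formula for exp is the uniqueness of geodesics. The acceleration of a
geodesic c is normal to the hyperboloid, hence a multiple of c; differentiating
mink c c = - k ^- 2 twice identifies the factor as k^2 times the squared speed,
which is constant. So c solves the linear equation c'' = (k r)^2 c
([geodesic_hyperbola], [exp_map_hyperbolic]).

Both tangent spaces are then parametrized isometrically by the same space of
matrices Y with n.+1 rows in R^n. On the target side, the i-th row of Y is
sent to the tangent space at x_i by the frame E z followed by parallel
transport along the geodesic from z to x_i. On the source side, the components
b_i = Y_i . t_i along the unit vectors t_i form a vector of R^(n.+1), which is
read as (dr, dz) in R x R^n, and the components orthogonal to the t_i are the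
displacements of the t_i on their spheres. In these coordinates the
differential is
  Y |-> s Y + V (b),    with    V (b)_i . t_i = b . (1, t_i) - s b_i:
moving t_i on the sphere only scales by s, and the derivative of the frame has
a skew-symmetric tangential part, which maps t_i to a vector orthogonal to t_i.
The differential is thus s times the identity plus a map that factors through
R^(n.+1), and Sylvester's determinant identity ([det_scalar_addM]) reduces it
to a determinant of size n.+1, in which only the products V (b)_i . t_i enter:
  det = s^(n (n + 1) - (n + 1)) det (1 | t) = s^(n^2 - 1) det (1 | t).
Isometric coordinates make any other choice of orthonormal bases change this
value by a sign only ([jacobian_coordinates]).

It remains to see that |det (1 | t)| is n! times the volume of the simplex
([lebesgue_simplex]). The volume is an iterated integral, for which the linear
change of variables is proved by induction on the dimension: block triangular
matrices are handled by the induction hypothesis and by the scaling of the line,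
the exchange of the first two coordinates is Tonelli's theorem, and these
generate the linear group. This reduces the claim to the standard corner
simplex, whose sections are corner simplices, and a degenerate simplex lies in
a hyperplane. *)

(** * Integration over the line *)

Section one_dim.
Context {R : realType}.
Local Notation mu := (@lebesgue_measure R).

Lemma lebesgue_measure_affine (a b : R) (A : set R) : 0 < a ->
  measurable A ->
  pushforward mu ((fun x => a * x + b) : R -> measurableTypeR R) A
  = (a^-1%:E * mu A)%E.
Proof.
move=> a0 mA.
have mf : measurable_fun setT ((fun x => a * x + b) : R -> measurableTypeR R).
  by apply: measurable_funD => //; exact: measurable_funM.
pose f0 := ((fun x => a * x + b) : R -> measurableTypeR R).
suff -> : mu A = (a%:E * pushforward mu f0 A)%E.
  by rewrite muleA -EFinM mulVf ?mul1e// gt_eqF.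
pose phi : {mfun R >-> measurableTypeR R} :=
  HB.pack f0 (isMeasurableFun.Build _ _ _ _ _ mf).
have := @lebesgue_measure_unique R
  (mscale (NngNum (ltW a0)) (pushforward mu phi)).
apply => //= _ [[p q]] _ <-.
rewrite [RHS]/= /mscale /=; rewrite /pushforward.
rewrite (_ : _ @^-1` _ = `]((p - b) / a), ((q - b) / a)]%classic); last first.
  apply/seteqP; split => x /=; rewrite !in_itv /= ltr_pdivrMr// ler_pdivlMr//;
  by rewrite ltrBlDr lerBrDr (mulrC x).
rewrite !lebesgue_measure_itv/= !lte_fin ltr_pM2r ?invr_gt0// ltrD2r.
case: ifP => _; last by rewrite mule0.
by rewrite -!EFinB -EFinM; congr EFin; field; rewrite gt_eqF.
Qed.

Lemma integral_affine (a b : R) (f : R -> \bar R) : a != 0 ->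
  measurable_fun setT f -> (forall x, 0 <= f x)%E ->
  (\int[mu]_x f (a * x + b)%R = `|a|^-1%:E * \int[mu]_x f x)%E.
Proof.
move=> a0 mf f0.
wlog : a b f a0 mf f0 / 0 < a => [wl|].
  have [/wl|] := ltP 0 a; first exact.
  rewrite le_eqVlt (negPf a0) /= => an.
  have mN : measurable_fun setT (-%R : R -> measurableTypeR R) by [].
  have mf' : measurable_fun setT (fun x => f (a * x + b)%R).
    by apply: measurableT_comp => //; apply: measurable_funD => //;
       exact: measurable_funM.
  transitivity (\int[mu]_x f (- a * x + b)%R)%E.
    rewrite (eq_measure_integral (pushforward mu
      (-%R : R -> measurableTypeR R)))//.
      rewrite ge0_integral_pushforward//=.
      by apply: eq_integral => x _ /=; rewrite mulrN mulNr.
    by move=> A mA _; exact/esym/lebesgue_measureN.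
  by rewrite wl ?oppr_eq0 ?normrN ?oppr_gt0.
move=> agt.
have mphi : measurable_fun setT ((fun x => a * x + b) : R -> measurableTypeR R).
  by apply: measurable_funD => //; exact: measurable_funM.
pose phi := ((fun x => a * x + b) : R -> measurableTypeR R).
transitivity (\int[pushforward mu phi]_x f x)%E.
  by rewrite ge0_integral_pushforward.
have ai : 0 <= a^-1 by rewrite invr_ge0 ltW.
rewrite (eq_measure_integral (mscale (NngNum ai) mu)).
  by rewrite ge0_integral_mscale//= gtr0_norm.
by move=> A mA _; exact: lebesgue_measure_affine.
Qed.

(** The integral of a nonnegative function is a supremum over the simple
functions below it, hence monotone for arbitrary functions. This bounds the
volume of a degenerate simplex without studying its measurability. *)
Lemma le_integral_lebesgue (f g : R -> \bar R) : (forall x, 0 <= f x)%E ->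
  (forall x, f x <= g x)%E -> (\int[mu]_x f x <= \int[mu]_x g x)%E.
Proof.
move=> f0 fg.
have g0 x : (0 <= g x)%E by apply: le_trans (fg x).
rewrite !ge0_integralTE//; apply: ereal_sup_le => _ [h hf <-].
by exists h => // x; apply: le_trans (fg x).
Qed.

End one_dim.

(** * Linear changes of variables for the iterated Lebesgue measure *)

Section many_dim.
Context {R : realType}.
Local Notation mu := (@lebesgue_measure R).

(** Generators of the product sigma-algebra on row vectors, for which the
coordinates are measurable. *)
Definition cylinders n : set (set 'rV[R]_n) :=
  [set A | exists (i : 'I_n) (B : set R), measurable B /\ A =
    [set x : 'rV[R]_n | B (x 0 i)]].
Arguments cylinders : clear implicits.
Notation MR := (measurableTypeR R).
Notation rVm n := (g_sigma_algebraType (cylinders n)).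

Lemma measurable_coord n i : measurable_fun setT (fun x : rVm n => x 0 i : R).
Proof.
move=> _ B mB; rewrite setTI; apply: sub_sigma_algebra.
by exists i, B.
Qed.

Lemma measurable_rV d (T : measurableType d) n (f : T -> rVm n) :
  (forall i, measurable_fun setT (fun x => f x 0 i : R)) ->
  measurable_fun setT f.
Proof.
move=> mf; apply: (@measurability _ _ T (rVm n) setT f (cylinders n)) => //.
move=> _ [_ [i [B [mB ->]]] <-].
by have := mf i measurableT B mB; rewrite setTI.
Qed.

Lemma lebesgue_rV_ge0 n (A : set 'rV[R]_n) : (0 <= lebesgue_rV A)%E.
Proof.
elim: n A => [|n ih] A /=; first by rewrite lee_fin.
by apply: integral_ge0 => x _; exact: ih.
Qed.

Lemma le_lebesgue_rV n (A B : set 'rV[R]_n) : A `<=` B ->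
  (lebesgue_rV A <= lebesgue_rV B)%E.
Proof.
elim: n A B => [|n ih] A B AB /=.
  rewrite lee_fin /indic; case: (boolP (0 \in A)) => //=.
  by move=> /set_mem /AB /mem_set ->.
apply: le_integral_lebesgue => x; first exact: lebesgue_rV_ge0.
by apply: ih => y; exact: AB.
Qed.

Lemma measurable_row_mx n :
  measurable_fun setT (fun p : MR * rVm n => row_mx (p.1%:M : 'rV_1) p.2 :
    rVm n.+1).
Proof.
apply: measurable_rV => i.
rewrite -[i](@splitK 1 n); case: (@fintype.split 1 n i) => j /=.
  rewrite (_ : (fun _ => _) = fst); first exact: measurable_fst.
  apply/funext => x; apply: etrans (@row_mxEl _ 1 1 n _ _ _ _) _.
  by rewrite mxE (ord1 j) eqxx mulr1n.
rewrite (_ : (fun _ => _) = (fun x : rVm n => x 0 j : R) \o snd).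
  by apply: measurableT_comp => //; exact: measurable_coord.
by apply/funext => x /=; apply: (@row_mxEr _ 1 1 n).
Qed.

(** The parameter space T is arbitrary so that the induction can move the first
coordinate of the vector into the parameter; the integral over this coordinate
is then measurable by Tonelli's theorem. *)
Lemma measurable_lebesgue_rV d (T : measurableType d) n (A : set (T * rVm n)) :
  measurable A ->
  measurable_fun setT (fun x => lebesgue_rV [set y : 'rV[R]_n | A (x, y)]).
Proof.
elim: n d T A => [|n ih] d T A mA /=.
  apply/measurable_EFinP.
  rewrite (_ : (fun _ => _) = \1_[set x : T | A (x, 0)]).
    apply: measurable_indic.
    have m0 : measurable_fun setT (fun x : T => (x, 0 : rVm 0)).
      by apply: measurable_fun_pair; [exact: measurable_id|exact:
        measurable_cst].
    by have := m0 measurableT _ mA; rewrite setTI.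
  by apply/funext => x.
pose f (p : T * MR) := lebesgue_rV [set y : 'rV[R]_n |
   A (p.1, row_mx (p.2%:M : 'rV_1) y)].
have mf : measurable_fun setT f.
  pose A' : set ((T * MR) * rVm n) :=
    [set q | A (q.1.1, row_mx (q.1.2%:M : 'rV_1) q.2 : rVm n.+1)].
  apply: (ih _ _ A').
  suff m : measurable_fun setT (fun q : (T * MR) * rVm n =>
    (q.1.1, row_mx (q.1.2%:M : 'rV_1) q.2 : rVm n.+1)).
    by have := m measurableT _ mA; rewrite setTI.
  apply/measurable_fun_pairP; split => /=.
    exact: (measurableT_comp measurable_fst measurable_fst).
  have m1 : measurable_fun setT (fun q : (T * MR) * rVm n => (q.1.2, q.2)).
    apply: measurable_fun_pair => //.
    exact: (measurableT_comp measurable_snd measurable_fst).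
  exact: (measurableT_comp (@measurable_row_mx n) m1).
by apply: (@measurable_fun_fubini_tonelli_F _ _ T MR R mu f) => // p;
  exact: lebesgue_rV_ge0.
Qed.

Lemma measurable_affine n m (M : 'M[R]_(n, m)) (b : 'rV[R]_m) :
  measurable_fun setT (fun x : rVm n => x *m M + b : rVm m).
Proof.
apply: measurable_rV => i.
under eq_fun do rewrite !mxE.
apply: measurable_funD; last exact: measurable_cst.
apply: measurable_sum => j.
by apply: measurable_funM; [exact: measurable_coord | exact: measurable_cst].
Qed.

Lemma measurable_preaffine n m (M : 'M[R]_(n, m)) (b : 'rV[R]_m)
    (A : set (rVm m)) : measurable A ->
  measurable [set x : rVm n | A (x *m M + b)].
Proof.
by move=> mA; have := measurable_affine M b measurableT mA; rewrite setTI.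
Qed.

Lemma measurable_premulmx n m (M : 'M[R]_(n, m)) (A : set (rVm m)) :
  measurable A -> measurable [set x : rVm n | A (x *m M)].
Proof.
move=> mA; have := measurable_preaffine M 0 mA.
by rewrite (_ : [set x | _] = [set x | A (x *m M)])//; apply/seteqP; split=>
  x /=; rewrite addr0.
Qed.

Lemma measurable_section n (A : set (rVm n.+1)) (x : R) : measurable A ->
  measurable [set y : rVm n | A (row_mx (x%:M : 'rV_1) y)].
Proof.
move=> mA.
have m : measurable_fun setT (fun y : rVm n => row_mx (x%:M : 'rV_1) y :
  rVm n.+1).
  apply: (measurableT_comp (@measurable_row_mx n)
    (g := fun y : rVm n => (x, y))).
  by apply: measurable_fun_pair; [exact: measurable_cst | exact: measurable_id].
by have := m measurableT _ mA; rewrite setTI.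
Qed.

Lemma measurable_lebesgue_section n (A : set (rVm n.+1)) : measurable A ->
  measurable_fun setT
    (fun x : MR => lebesgue_rV [set y :
      'rV[R]_n | A (row_mx (x%:M : 'rV_1) y)]).
Proof.
move=> mA; pose A' : set (MR * rVm n) :=
  [set q | A (row_mx (q.1%:M : 'rV_1) q.2)].
apply: (@measurable_lebesgue_rV _ MR n A').
by have := measurable_row_mx measurableT mA; rewrite setTI.
Qed.

Lemma lebesgue_rV_translate n (b : 'rV[R]_n) (A : set (rVm n)) : measurable A ->
  lebesgue_rV [set x : 'rV[R]_n | A (x + b)] = lebesgue_rV A.
Proof.
elim: n b A => [|n ih] b A mA /=.
  by congr (\1__ 0)%:E; apply/funext => x /=; rewrite [b]thinmx0 addr0.
pose b0 := lsubmx (b : 'M[R]_(1, 1 + n)); pose b1 :=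
  rsubmx (b : 'M[R]_(1, 1 + n)).
transitivity (\int[mu]_x lebesgue_rV
   [set y : 'rV[R]_n | A (row_mx ((1 * x + b0 0 0)%R%:M : 'rV_1) y)])%E.
  apply: eq_integral => x _.
  have E (y : 'rV[R]_n) : row_mx (x%:M : 'M[R]_1) y + b =
      row_mx (1 * x + b0 0 0)%:M (y + b1).
    rewrite mul1r raddfD /= -mx11_scalar -(@add_row_mx _ 1 1 n) /b0 /b1.
    by rewrite (@hsubmxK _ 1 1 n).
  rewrite -(ih b1 _ (measurable_section (1 * x + b0 0 0) mA)).
  congr lebesgue_rV; apply/seteqP.
  by split=> y /=; rewrite E.
rewrite (integral_affine (b0 0 0) (f := fun x => lebesgue_rV
  [set y : 'rV[R]_n | A (row_mx (x%:M : 'rV_1) y)])) ?oner_neq0//.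
- by rewrite normr1 invr1 mul1e.
- exact: measurable_lebesgue_section.
- by move=> x; exact: lebesgue_rV_ge0.
Qed.

(** The change of variables formula for the matrix M, as a property of M: the
matrices that have it form a group, so it is enough to treat generators. *)
Definition lebesgue_scales n (M : 'M[R]_n) := M \in unitmx /\
  forall A : set (rVm n), measurable A ->
  lebesgue_rV [set x : 'rV[R]_n | A (x *m M)] =
    (`|\det M|^-1%:E * lebesgue_rV A)%E.

Lemma lebesgue_scalesM n (M N : 'M[R]_n) :
  lebesgue_scales M -> lebesgue_scales N -> lebesgue_scales (M *m N).
Proof.
move=> [uM hM] [uN hN]; split; first by rewrite unitmx_mul uM.
move=> A mA; rewrite det_mulmx normrM invfM EFinM -muleA -hN//.
rewrite -(hM [set x : rVm n | A (x *m N)]); last exact: measurable_premulmx.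
by congr lebesgue_rV; apply/seteqP; split=> x /=; rewrite mulmxA.
Qed.

Lemma lebesgue_scalesV n (M : 'M[R]_n) :
  lebesgue_scales M -> lebesgue_scales (invmx M).
Proof.
move=> [uM hM]; split; first by rewrite unitmx_inv.
move=> A mA.
have := hM _ (measurable_premulmx (invmx M) mA).
rewrite (_ : [set x | [set y : rVm n | A (y *m invmx M)] (x *m M)] = A);
  last first.
  by apply/seteqP; split=> x /=; rewrite -mulmxA mulmxV// mulmx1.
move=> ->; rewrite muleA -EFinM det_inv normfV invrK divff ?mul1e//.
by rewrite normr_eq0 -unitfE -unitmxE.
Qed.

(** With this block shape the first coordinate of x *m M depends only on the
first coordinate of x, so the formula can be proved section by section. The row
b translates the sections, which does not change their measure. *)
Lemma lebesgue_scales_ublock n (a : R) (b : 'rV[R]_n) (D : 'M[R]_n) :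
  a != 0 -> lebesgue_scales D ->
  lebesgue_scales (block_mx (a%:M : 'M[R]_1) b 0 D : 'M[R]_(1 + n)).
Proof.
move=> a0 [uD hD]; split.
  by rewrite unitmxE det_ublock unitrM -!unitmxE uD unitmxE det_scalar1 unitfE
    a0.
move=> A mA; rewrite det_ublock det_scalar1 /=.
rewrite normrM invfM EFinM -muleA.
transitivity (\int[mu]_x (`|\det D|^-1%:E * lebesgue_rV
   [set y : 'rV[R]_n | A (row_mx ((a * x + 0)%R%:M : 'rV_1) y)]))%E.
  apply: eq_integral => x _.
  pose B := [set y : rVm n | A (row_mx ((a * x + 0)%:M : 'rV_1) y)].
  have mB : measurable B by exact: measurable_section.
  rewrite -(lebesgue_rV_translate (x *: b) mB).
  have mB' : measurable [set y : rVm n | B (y + x *: b)].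
    have := measurable_preaffine 1%:M (x *: b) mB.
    by under eq_set do rewrite mulmx1.
  rewrite -(hD _ mB'); congr lebesgue_rV; apply/seteqP.
  split => y /=; rewrite (@mul_row_block _ 1 1 n 1 n) -scalar_mxM mulmx0 addr0.
    by rewrite mul_scalar_mx /B /= addr0 mulrC [X in row_mx _ X]addrC.
  by rewrite mul_scalar_mx /B /= addr0 mulrC [X in row_mx _ X]addrC.
have mf := measurable_lebesgue_section mA.
have f0 (x : R) := lebesgue_rV_ge0 [set y :
  'rV[R]_n | A (row_mx (x%:M : 'rV_1) y)].
have mh : measurable_fun setT ((fun x => a * x + 0) : MR -> MR).
  by apply: measurable_funD => //; exact: measurable_funM.
have mfh := measurableT_comp mf mh.
have d0 : 0 <= `|\det D|^-1 by rewrite invr_ge0.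
rewrite (ge0_integralZl_EFin _ measurableT _ mfh d0)//; last first.
  by move=> x _; exact: f0.
by rewrite (integral_affine 0 a0 mf f0) muleCA.
Qed.

Lemma row_cons0 n (x : R) (v : 'rV[R]_n) :
  (row_mx (x%:M : 'M[R]_1) v : 'rV_n.+1) 0 ord0 = x.
Proof.
have -> : ord0 = lshift n (ord0 : 'I_1) by apply/val_inj.
by rewrite (@row_mxEl _ 1 1 n) mxE mulr1n.
Qed.

Lemma row_consS n (x : R) (v : 'rV[R]_n) i :
  (row_mx (x%:M : 'M[R]_1) v : 'rV_n.+1) 0 (lift ord0 i) = v 0 i.
Proof.
have -> : lift ord0 i = rshift 1 i by apply/val_inj.
by rewrite (@row_mxEr _ 1 1 n).
Qed.

Lemma row_mx_swap n (x y : R) (w : 'rV[R]_n) :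
  row_mx (x%:M : 'M[R]_1) (row_mx (y%:M : 'M[R]_1) w) *m tperm_mx 0 1 =
  row_mx (y%:M : 'M[R]_1) (row_mx (x%:M : 'M[R]_1) w) :> 'rV_n.+2.
Proof.
rewrite -xcolE; apply/rowP => j; rewrite mxE.
have e1 : 1 = lift ord0 ord0 :> 'I_n.+2 by apply/val_inj.
case: (unliftP ord0 j) => [i ->|->]; last by rewrite tpermL e1 row_consS
  !row_cons0.
case: (unliftP ord0 i) => [l ->|->]; last by rewrite -e1 tpermR e1 row_consS
  !row_cons0.
by rewrite tpermD ?e1 ?(inj_eq lift_inj) ?neq_lift// !row_consS.
Qed.

(** Two iterated integrals in the opposite order, hence Tonelli's theorem. This
is the only generator that mixes the first coordinate with the others in a way
that sections do not see. *)
Lemma lebesgue_scales_swap n :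
  lebesgue_scales (tperm_mx 0 1 : 'M[R]_n.+2).
Proof.
split; first by rewrite unitmxE det_perm unitrX// unitrN1.
move=> A mA; rewrite det_perm normrX normrN1 expr1n invr1 mul1e /=.
pose f (p : MR * MR) := lebesgue_rV [set y : 'rV[R]_n |
   A (row_mx (p.1%:M : 'rV_1) (row_mx (p.2%:M : 'rV_1) y))].
have mf : measurable_fun setT f.
  pose A' : set ((MR * MR) * rVm n) := [set q |
     A (row_mx (q.1.1%:M : 'rV_1) (row_mx (q.1.2%:M : 'rV_1) q.2))].
  apply: (@measurable_lebesgue_rV _ (MR * MR)%type n A').
  have m1 : measurable_fun setT (fun q : (MR * MR) * rVm n => (q.1.2, q.2)).
    apply: measurable_fun_pair => //.
    exact: (measurableT_comp measurable_snd measurable_fst).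
  have m2 := measurableT_comp (@measurable_row_mx n) m1.
  have m3 : measurable_fun setT (fun q : (MR * MR) * rVm n =>
     (q.1.1, row_mx (q.1.2%:M : 'rV_1) q.2 : rVm n.+1)).
    apply: measurable_fun_pair => //.
    exact: (measurableT_comp measurable_fst measurable_fst).
  have m4 := measurableT_comp (@measurable_row_mx n.+1) m3.
  by have := m4 measurableT _ mA; rewrite setTI.
have f0 p : (0 <= f p)%E by exact: lebesgue_rV_ge0.
rewrite [RHS](@fubini_tonelli _ _ MR MR R mu mu f mf f0).
apply: eq_integral => x _; apply: eq_integral => y _.
by congr lebesgue_rV; apply/seteqP; split=> w /=; rewrite row_mx_swap.
Qed.

(** Gaussian elimination on a matrix of rank one. *)
Lemma cV_unitmx_delta n (c : 'cV[R]_n.+1) : c != 0 ->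
  exists (L : 'M[R]_n.+1) (rho : R),
    [/\ L \in unitmx, rho != 0 & c = L *m (rho *: delta_mx 0 0)].
Proof.
move=> c0; pose rho := row_ebase c 0 0.
have rc : \rank c = 1%N.
  by apply/eqP; rewrite eqn_leq rank_leq_col lt0n mxrank_eq0.
have cE : c = col_ebase c *m (rho *: delta_mx 0 0).
  rewrite -{1}(mulmx_ebase c) rc -mulmxA; congr (_ *m _).
  rewrite (mx11_scalar (row_ebase c)) mul_mx_scalar; congr (_ *: _).
  by apply/matrixP=> i j; rewrite !mxE (ord1 j) eqxx andbT /=; case: i => -[|i].
exists (col_ebase c), rho; split=> //; first exact: col_ebase_unit.
by apply: contra_neq c0 => r0; rewrite cE r0 scale0r mulmx0.
Qed.

(** By induction on the dimension: row operations within the last coordinates,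
a shear and an exchange bring the first column of M to a multiple of the first
basis vector, and what is left is block triangular. *)
Lemma lebesgue_scales_unitmx n (M : 'M[R]_n) : M \in unitmx ->
  lebesgue_scales M.
Proof.
elim: n M => [|n ih] M uM.
  split=> // A mA; rewrite det_mx00 normr1 invr1 mul1e.
  by congr lebesgue_rV; apply/seteqP; split=> x /=;
    rewrite (thinmx0 (x *m M)) (thinmx0 x).
have parab (N : 'M[R]_(1 + n)) : N \in unitmx -> dlsubmx N = 0 ->
  lebesgue_scales N.
  move=> uN N0.
  have NE : N = block_mx (ulsubmx N 0 0)%:M (ursubmx N) 0 (drsubmx N).
    by rewrite -mx11_scalar -N0 submxK.
  move: uN; rewrite NE.
  rewrite unitmxE det_ublock det_scalar1 unitrM unitfE -unitmxE => /andP[a0 uD].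
  by apply: lebesgue_scales_ublock => //; exact: ih.
(* It is enough to clear the first column of M below its first entry. *)
suff [U [gU uU UM]] : exists U : 'M[R]_(1 + n),
    [/\ lebesgue_scales U, U \in unitmx & dsubmx
      (U *m lsubmx (M : 'M[R]_(1 + n))) = 0].
  rewrite -[M]mul1mx -(mulVmx uU) -mulmxA.
  apply: lebesgue_scalesM; first exact: lebesgue_scalesV.
  apply: parab; first by rewrite unitmx_mul uU.
  move: UM; rewrite mulmx_lsub => UM.
  by rewrite -UM; apply/matrixP=> i j; rewrite !mxE.
clear parab; case: n ih M uM => [|n] ih M uM.
  exists 1%:M; rewrite unitmx1 [dsubmx _]flatmx0; split=> //.
  split; first exact: unitmx1.
  by move=> A mA; rewrite det1 normr1 invr1 mul1e; congr lebesgue_rV;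
    apply/seteqP; split=> x /=; rewrite mulmx1.
set v := lsubmx _.
have [c0|c0] := eqVneq (dsubmx v) 0.
  exists 1%:M; rewrite unitmx1 mul1mx; split=> //.
  split; first exact: unitmx1.
  by move=> A mA; rewrite det1 normr1 invr1 mul1e; congr lebesgue_rV;
    apply/seteqP; split=> x /=; rewrite mulmx1.
set c := dsubmx v in c0.
have [L [rho [uL rho0 cE]]] := cV_unitmx_delta c0.
pose U1 := block_mx (1%:M : 'M[R]_1) (0 : 'rV_n.+1) 0 (invmx L).
pose U2 := block_mx (1%:M : 'M[R]_1) ((- (usubmx v 0 0 / rho)) *: delta_mx 0
  0 : 'rV_n.+1) 0 1%:M.
have gU1 : lebesgue_scales U1.
  apply: lebesgue_scales_ublock; first exact: oner_neq0.
  by apply: ih; rewrite unitmx_inv.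
have gU2 : lebesgue_scales U2.
  apply: lebesgue_scales_ublock; first exact: oner_neq0.
  by apply: ih; exact: unitmx1.
have gU := lebesgue_scalesM (lebesgue_scales_swap n) (lebesgue_scalesM gU2 gU1).
(* The first column is (v_0, c). U1 turns c into rho times the first basis
vector, the shear U2 uses this entry to cancel v_0, and the exchange of the
first two rows brings rho to the top. *)
exists (tperm_mx 0 1 *m (U2 *m U1)); split=> //; first by case: gU.
have E1 : U2 *m U1 *m v = col_mx (0 : 'M[R]_1) (rho *: delta_mx 0 0).
  rewrite -mulmxA -[v]vsubmxK -/c (mul_block_col _ _ _ _ (usubmx v)).
  rewrite mul1mx !mul0mx addr0 add0r cE mulKmx//.
  rewrite mul_block_col !mul1mx mul0mx add0r; congr col_mx.
  rewrite -scalemxAl -scalemxAr mul_delta_mx scalerA mulNr divfK//.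
  by apply/matrixP=> i j; rewrite (ord1 i) (ord1 j) !mxE eqxx mulr1 subrr.
rewrite -mulmxA E1 -xrowE; apply/matrixP => i j;
  rewrite [LHS]mxE [LHS]mxE (ord1 j).
have e0 : 0 = lshift n.+1 ord0 :> 'I_(1 + n.+1) by apply/val_inj.
have e1 : 1 = rshift 1 ord0 :> 'I_(1 + n.+1) by apply/val_inj.
case: (unliftP ord0 i) => [l ->|->].
  rewrite tpermD; last 2 first.
  - by rewrite e0; apply/eqP => /(congr1 val).
  - by rewrite e1; apply/eqP => /(congr1 val).
  by rewrite col_mxEd !mxE mulr0.
by rewrite -e1 tpermR e0 col_mxEu !mxE.
Qed.

End many_dim.

(** * The volume of a simplex *)

Section simplex_volume.
Context {R : realType}.
Local Notation mu := (@lebesgue_measure R).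
Local Notation rVm n := (g_sigma_algebraType (@cylinders R n)).

(** The convex hull of 0 and of c times the basis vectors, when 0 <= c. *)
Definition corner n (c : R) : set 'rV[R]_n :=
  [set x | (forall i, 0 <= x 0 i) /\ \sum_i x 0 i <= c].
Arguments corner : clear implicits.

Lemma measurable_corner n c : measurable (corner n c : set (rVm n)).
Proof.
have -> : corner n c = (\bigcap_(i in [set: 'I_n]) [set x : rVm n | 0 <= x 0 i])
    `&` [set x : rVm n | \sum_i x 0 i <= c].
  apply/seteqP; split=> x [h1 h2]; split=> // i; last exact: h1.
  by move=> _; exact: h1.
apply: measurableI.
  apply: fin_bigcap_measurable => // i _.
  have := measurable_coord i measurableT (measurable_itv `[(0:R), +oo[).
  rewrite setTI; congr measurable.
  by apply/seteqP; split=> x /=; rewrite in_itv /= andbT.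
have ms : measurable_fun setT (fun x : rVm n => \sum_i x 0 i : R).
  by apply: measurable_sum => i; exact: measurable_coord.
have := ms measurableT _ (measurable_itv `]-oo, c]).
by rewrite setTI.
Qed.

Lemma is_derive_pow_sub (c x : R) n :
  is_derive x 1 (fun y => - ((c - y) ^+ n.+1 / n.+1`!%:R))
    ((c - x) ^+ n / n`!%:R).
Proof.
have h := is_deriveN (is_deriveM
  (is_deriveX n.+1 (is_deriveB (is_derive_cst c x 1) (is_derive_id x (1 : R))))
  (is_derive_cst (n.+1`!%:R^-1 : R) x (1 : R))).
have <- : - ((cst c - id) ^+ n.+1 * cst (n.+1`!%:R^-1)) =
    fun y => - ((c - y) ^+ n.+1 / n.+1`!%:R) by apply/funext => y;
      rewrite !fctE.
refine (is_derive_eq h _).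
rewrite scaler0 add0r sub0r /GRing.scale /= factS natrM.
have f0 : n`!%:R != 0 :> R by rewrite pnatr_eq0 -lt0n fact_gt0.
have n0 : n.+1%:R != 0 :> R by rewrite pnatr_eq0.
rewrite /cst /= -[(_ - _) x]/(c - x); field.
by rewrite f0 nat1r n0.
Qed.

Lemma integral_pow_sub (c : R) n : 0 <= c ->
  (\int[mu]_(x in `[0%R, c]) ((c - x) ^+ n / n`!%:R)%:E =
    (c ^+ n.+1 / n.+1`!%:R)%:E)%E.
Proof.
rewrite le_eqVlt => /predU1P[<-|c0].
  by rewrite set_itv1 integral_set1 expr0n mul0r.
pose F y := - ((c - y) ^+ n.+1 / n.+1`!%:R).
have cF y : {for y, continuous F}.
  apply: differentiable_continuous; apply/derivable1_diffP.
  by have [] := is_derive_pow_sub c y n.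
rewrite (@continuous_FTC2 _ (fun x => (c - x) ^+ n / n`!%:R) F)//.
- have -> : F 0 = - (c ^+ n.+1 / n.+1`!%:R) by rewrite /F subr0.
  have -> : F c = 0 by rewrite /F subrr expr0n mul0r oppr0.
  by rewrite -EFinB sub0r opprK.
- apply: continuous_subspaceT => x.
  apply: differentiable_continuous; apply/derivable1_diffP.
  case: n {F cF} => [|n].
    under eq_fun do rewrite expr0; exact: derivable_cst.
  have [dF _] := is_derive_pow_sub c x n.
  pose G y := - ((c - y) ^+ n.+1 / n.+1`!%:R).
  have -> : (fun y => (c - y) ^+ n.+1 / n.+1`!%:R) = - G.
    by apply/funext => y; rewrite fctE /G opprK.
  exact: derivableN.
- split; first by move=> x _; have [] := is_derive_pow_sub c x n.
    by apply: cvg_at_right_filter; exact: cF.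
  by apply: cvg_at_left_filter; exact: cF.
by move=> x _; rewrite derive1E; have [_ ->] := is_derive_pow_sub c x n.
Qed.

Lemma lebesgue_rV0 n : lebesgue_rV (set0 : set 'rV[R]_n) = 0%E.
Proof.
elim: n => [|n ih] /=; first by rewrite indic0.
by rewrite integral0_eq// => x _; rewrite -[RHS]ih; congr lebesgue_rV.
Qed.

Lemma lebesgue_corner n (c : R) :
  lebesgue_rV (corner n c) = (if 0 <= c then c ^+ n / n`!%:R else 0)%:E.
Proof.
elim: n c => [|n ih] c /=.
  rewrite indicE expr0 fact0 divr1; congr EFin.
  case: ifPn => c0; last first.
    by rewrite memNset// => -[_]; rewrite big_ord0; apply/negP.
  by rewrite mem_set//; split => [[]//|]; rewrite big_ord0.
have E x : lebesgue_rV [set y : 'rV[R]_n | corner n.+1 c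
  (row_mx (x%:M : 'M[R]_1) y)]
    = (((fun x => ((c - x) ^+ n / n`!%:R)%:E) \_ `[0%R, c]) x).
  rewrite patchE; case: ifPn => [|].
    rewrite inE /= in_itv /= => /andP[x0 xc].
    have := ih (c - x); rewrite subr_ge0 xc => <-.
    congr lebesgue_rV; apply/seteqP; split=> y [h1 h2]; split.
    - by move=> i; have := h1 (lift ord0 i); rewrite row_consS.
    - move: h2; rewrite big_ord_recl row_cons0 lerBrDl.
      by under eq_bigr do rewrite row_consS.
    - by move=> i; case: (unliftP ord0 i) => [j|] ->;
      rewrite (row_consS, row_cons0).
    - rewrite big_ord_recl row_cons0 -lerBrDl.
      by under eq_bigr do rewrite row_consS.
  move=> xn; have -> : [set y : 'rV[R]_n | corner n.+1 c
    (row_mx (x%:M : 'M[R]_1) y)] = set0.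
    apply/seteqP; split=> // y [h1 h2]; move/negP: xn; apply.
    rewrite inE /= in_itv /=; apply/andP; split.
      by have := h1 ord0; rewrite row_cons0.
    apply: le_trans h2; rewrite big_ord_recl row_cons0 lerDl.
    by apply: sumr_ge0.
  exact: lebesgue_rV0.
under eq_integral do rewrite E.
rewrite -integral_mkcond; case: ifPn => c0; first exact: integral_pow_sub.
by rewrite set_itv_ge ?integral_set0// bnd_simp.
Qed.

(** Eliminating the coefficient of the first vertex turns barycentric
coordinates into a point of the standard corner simplex. *)
Lemma simplexP m n (t : 'M[R]_(m.+1, n)) (x : 'rV[R]_n) :
  simplex t x <-> exists2 y, corner m 1 y &
    x = row ord0 t + y *m (\matrix_i (row (lift ord0 i) t - row ord0 t)).
Proof.
have E (y : 'rV[R]_m) : y *m (\matrix_i (row (lift ord0 i) t - row ord0 t)) =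
  \sum_i y 0 i *: row (lift ord0 i) t - (\sum_i y 0 i) *: row ord0 t.
  rewrite mulmx_sum_row scaler_suml -sumrB; apply: eq_bigr => i _.
  by rewrite rowK scalerBr.
split=> [[a [a0 a1 ->]]|[y [y0 y1] ->]].
  exists (\row_i a (lift ord0 i)).
    split; first by move=> i; rewrite mxE.
    under eq_bigr do rewrite mxE.
    by rewrite -a1 big_ord_recl lerDr.
  have -> : \sum_i a i *: row i t = (1 - \sum_i a (lift ord0 i)) *: row ord0 t +
      \sum_i a (lift ord0 i) *: row (lift ord0 i) t.
    by rewrite big_ord_recl -a1 big_ord_recl addrK.
  rewrite E; under [in RHS]eq_bigr do rewrite mxE.
  under [X in _ - X *: _]eq_bigr do rewrite mxE.
  by rewrite scalerBl scale1r addrAC addrA.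
pose a i := if unlift ord0 i is Some j then y 0 j else 1 - \sum_i y 0 i.
have a0 : a ord0 = 1 - \sum_i y 0 i by rewrite /a unlift_none.
have aS (i : 'I_m) : a (lift ord0 i) = y 0 i by rewrite /a liftK.
exists a; split.
- by move=> i; rewrite /a; case: unliftP => [j|] _ //; rewrite subr_ge0.
- by rewrite big_ord_recl; under eq_bigr do rewrite aS; rewrite a0 subrK.
- rewrite big_ord_recl; under [in RHS]eq_bigr do rewrite aS.
  rewrite a0 E.
  by rewrite scalerBl scale1r addrA [RHS]addrAC.
Qed.

(** A nondegenerate simplex is an affine image of the standard corner simplex.
A degenerate one lies in a hyperplane, which an invertible matrix brings to the
form y_0 = b; the section of this set is empty unless y_0 = b. *)
Theorem lebesgue_simplex n (t : 'M[R]_(n.+1, n)) :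
  (n`!%:R%:E * lebesgue_rV (simplex t) =
   `|\det (row_mx (const_mx 1 : 'cV_n.+1) t : 'M[R]_n.+1)|%:E)%E.
Proof.
pose V : 'M[R]_n := \matrix_i (row (lift ord0 i) t - row ord0 t).
pose t0 := row ord0 t.
have -> : \det (row_mx (const_mx 1 : 'cV_n.+1) t : 'M[R]_n.+1) = \det V.
  pose L : 'M[R]_(1 + n) := block_mx 1%:M 0 (const_mx 1) 1%:M.
  have -> : row_mx (const_mx 1 : 'cV_n.+1) t =
      L *m block_mx 1%:M t0 0 V.
    rewrite mulmx_block !mul1mx !mul0mx !addr0 mulmx1 block_mxEh.
    congr row_mx; apply/matrixP => i j; case: (unliftP ord0 i) => [l ->|->].
    - have -> : lift ord0 l = rshift 1 l by apply/val_inj.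
      by rewrite (@col_mxEd _ 1 n) !mxE.
    - have -> : ord0 = lshift n (ord0 : 'I_1) by apply/val_inj.
      by rewrite (@col_mxEu _ 1 n) !mxE (ord1 j).
    - have e : lift ord0 l = rshift 1 l by apply/val_inj.
      rewrite [in RHS]e (@col_mxEd _ 1 n) !mxE big_ord1 !mxE mul1r.
      by rewrite addrC subrK.
    - have e : ord0 = lshift n (ord0 : 'I_1) by apply/val_inj.
      by rewrite [in RHS]e (@col_mxEu _ 1 n) !mxE.
  by rewrite det_mulmx (@det_lblock _ 1 n) (@det_ublock _ 1 n) !det1 !mul1r.
have f0 : n`!%:R != 0 :> R by rewrite pnatr_eq0 -lt0n fact_gt0.
have [uV|nV] := boolP (V \in unitmx).
  pose B := [set y : rVm n | corner n 1 (y *m 1%:M + - (t0 *m invmx V))].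
  have mB : measurable B by apply: measurable_preaffine;
    exact: measurable_corner.
  have -> : simplex t = [set x | B (x *m invmx V)].
    apply/seteqP; split=> x.
      move/simplexP => [y hy ->]; rewrite /B /=.
      by rewrite mulmx1 mulmxDl mulmxK// addrAC subrr add0r.
    rewrite /B /= mulmx1 => h; apply/simplexP;
      exists (x *m invmx V - t0 *m invmx V) => //.
    by rewrite -mulmxBl mulmxKV// addrC subrK.
  have uV' : invmx V \in unitmx by rewrite unitmx_inv.
  have [_ /(_ _ mB) ->] := lebesgue_scales_unitmx uV'.
  rewrite /B; under eq_set do rewrite mulmx1.
  rewrite lebesgue_rV_translate; last exact: measurable_corner.
  rewrite lebesgue_corner ler01 expr1n -!EFinM; congr EFin.
  by rewrite det_inv normfV invrK mulrCA mul1r divff// mulr1.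
have [dV] : \det V = 0.
  by apply/eqP; move: nV; rewrite unitmxE unitfE negbK.
rewrite dV normr0; suff -> : lebesgue_rV (simplex t) = 0%E by rewrite mule0.
apply/eqP; rewrite eq_le lebesgue_rV_ge0 andbT.
case: n => [|n] in t V t0 f0 nV dV *.
  by move: nV; rewrite unitmxE det_mx00 unitr1.
have [c c0 Vc] : exists2 c : 'cV[R]_n.+1, c != 0 & V *m c = 0.
  move/eqP: dV; rewrite -det_tr => /det0P [v v0 vV].
  exists v^T; first by rewrite -trmx0 (inj_eq trmx_inj).
  by apply: trmx_inj; rewrite trmx_mul trmxK vV trmx0.
have [M [rho [uM rho0 cE]]] := cV_unitmx_delta c0.
pose b := (t0 *m c) 0 0 / rho.
(* The first column of M is a multiple of c, which V annihilates, so the first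
coordinate of x *m M is constant on the simplex. *)
pose B := [set y : rVm n.+1 | y 0 ord0 = b].
have mB : measurable B.
  rewrite -[X in measurable X]setTI.
  exact: (measurable_coord ord0 measurableT (measurable_set1 b)).
have sub : simplex t `<=` [set x | B (x *m M)].
  move=> x /simplexP[y _ ->]; rewrite /B /= /b.
  apply: (mulIf rho0); rewrite mulfVK//.
  transitivity (((t0 + y *m V) *m c) 0 0); last first.
    by rewrite mulmxDl -mulmxA Vc mulmx0 addr0.
  rewrite cE mulmxA -scalemxAr [RHS]mxE mulrC; congr (_ * _).
  by rewrite -colE [RHS]mxE.
apply: le_trans (le_lebesgue_rV sub) _.
have [_ /(_ _ mB) ->] := lebesgue_scales_unitmx uM.
suff -> : lebesgue_rV B = 0%E by rewrite mule0.
apply/eqP; rewrite eq_le lebesgue_rV_ge0 andbT /=.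
rewrite -(integral_set1 (fun=> +oo%E) b) [leRHS]integral_mkcond.
apply: le_integral_lebesgue => x; first exact: lebesgue_rV_ge0.
rewrite patchE; case: ifPn => [_|/negP xb]; first exact: leey.
rewrite (_ : [set y | _] = set0) ?lebesgue_rV0//.
apply/seteqP; split=> // y; rewrite /B /= row_cons0 => xb'; apply: xb.
by rewrite inE.
Qed.

End simplex_volume.

(** * Derivatives of curves *)

Section calculus.
Context {R : realType}.

Lemma is_derive_unique (W : normedModType R) (f : R -> W) (x : R) (a b : W) :
  is_derive x 1 f a -> is_derive x 1 f b -> a = b.
Proof. by move=> [_ <-] [_ <-]. Qed.

Lemma is_derive_mxP m n (f : R -> 'M[R]_(m, n)) (x : R) (df : 'M[R]_(m, n)) :
  is_derive x 1 f df <->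
  forall i j, is_derive x 1 (fun s => f s i j) (df i j).
Proof.
split=> [[fx <-] i j|h].
  have /derivable_mxP h := fx; apply: DeriveDef; first exact: h.
  by rewrite derive_mx// mxE.
have fx : derivable f x 1 by apply/derivable_mxP => i j; have [] := h i j.
apply: DeriveDef => //; rewrite derive_mx//; apply/matrixP => i j.
by rewrite mxE; have [_ ->] := h i j.
Qed.

Lemma is_derive_add (W : normedModType R) (f g : R -> W) (x : R) (df dg : W) :
  is_derive x 1 f df -> is_derive x 1 g dg ->
  is_derive x 1 (fun s => f s + g s) (df + dg).
Proof. exact: is_deriveD. Qed.

Lemma is_derive_mul (f g : R -> R) (x df dg : R) :
  is_derive x 1 f df -> is_derive x 1 g dg ->
  is_derive x 1 (fun s => f s * g s) (df * g x + f x * dg).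
Proof.
move=> hf hg; have h := is_deriveM hf hg.
by refine (is_derive_eq h _); rewrite addrC [df * _]mulrC.
Qed.

Lemma is_derive_bigsum n (h : 'I_n -> R -> R) (x : R) (dh : 'I_n -> R) :
  (forall i, is_derive x 1 (h i) (dh i)) ->
  is_derive x 1 (fun s => \sum_i h i s) (\sum_i dh i).
Proof. by move=> hh; have := is_derive_sum hh; rewrite fct_sumE. Qed.

Lemma is_derive_const (W : normedModType R) (a : W) (x : R) :
  is_derive x 1 (fun=> a) 0.
Proof. exact: is_derive_cst. Qed.

Lemma is_derive_scale m n (a : R -> R) (f : R -> 'M[R]_(m, n)) (x da : R) df :
  is_derive x 1 a da -> is_derive x 1 f df ->
  is_derive x 1 (fun s => a s *: f s) (da *: f x + a x *: df).
Proof.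
move=> ha /is_derive_mxP hf; apply/is_derive_mxP => i j.
rewrite !mxE; under eq_fun do rewrite mxE.
exact: is_derive_mul.
Qed.

Lemma is_derive_mulmx m n p (f : R -> 'M[R]_(m, n)) (g : R -> 'M[R]_(n, p))
    (x : R) df dg :
  is_derive x 1 f df -> is_derive x 1 g dg ->
  is_derive x 1 (fun s => f s *m g s) (df *m g x + f x *m dg).
Proof.
move=> /is_derive_mxP hf /is_derive_mxP hg; apply/is_derive_mxP => i j.
rewrite !mxE -big_split /=; under eq_fun do rewrite mxE.
by apply: is_derive_bigsum => l; exact: is_derive_mul.
Qed.

Lemma is_derive_row m n (f : R -> 'M[R]_(m, n)) (x : R) df i :
  is_derive x 1 f df -> is_derive x 1 (fun s => row i (f s)) (row i df).
Proof.
move=> /is_derive_mxP hf; apply/is_derive_mxP => a b.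
by rewrite mxE; under eq_fun do rewrite mxE.
Qed.

Lemma is_derive_rows m n (f : R -> 'M[R]_(m, n)) (x : R) df :
  (forall i, is_derive x 1 (fun s => row i (f s)) (row i df)) ->
  is_derive x 1 f df.
Proof.
move=> h; apply/is_derive_mxP => i j.
have /is_derive_mxP/(_ 0 j) := h i.
by rewrite mxE; under eq_fun do rewrite mxE.
Qed.

Lemma is_derive_continuous (W : normedModType R) (f : R -> W) (x : R) df :
  is_derive x 1 f df -> {for x, continuous f}.
Proof.
by move=> [h _]; apply: differentiable_continuous; exact/derivable1_diffP.
Qed.

Lemma is_derive_near_gt0 (f : R -> R) (x : R) df :
  is_derive x 1 f df -> 0 < f x -> \forall s \near x, 0 < f s.
Proof.
by move=> /is_derive_continuous cf f0; exact: (cvgr_gt (f x) cf _ f0).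
Qed.

(** Differentiates an identity that holds along a curve; identities that hold
only on a manifold are used in this way. *)
Lemma near_const_derive (W : normedModType R) (f : R -> W) (x : R) (a df : W) :
  is_derive x 1 f df -> (\forall s \near x, f s = a) -> df = 0.
Proof.
move=> hf fa; apply: (is_derive_unique hf).
by apply: near_eq_is_derive (is_derive_const a x); near do apply/esym.
Unshelve. all: by end_near. Qed.

Lemma derive0_const (f : R -> R) : (forall x : R, is_derive x 1 f 0) ->
  forall x, f x = f 0.
Proof. by move=> h x; exact: is_derive_0_is_cst. Qed.

Definition cosh (x : R) : R := (expR x + expR (- x)) / 2.

Lemma is_derive_expZ (a x : R) :
  is_derive x 1 (fun s => expR (a * s)) (a * expR (a * x)).
Proof.
have h := is_derive1_comp (f := expR) (g := fun s => a * s)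
  (is_derive_expR (a * x)) (is_derive_mul (is_derive_const a x)
    (is_derive_id x (1:R))).
by refine (is_derive_eq h _); rewrite mul0r add0r mulr1 mulrC.
Qed.

Lemma sinhE (a : R) : sinh a = (expR a - expR (- a)) / 2.
Proof. by []. Qed.

Lemma is_derive_cosh (a x : R) :
  is_derive x 1 (fun s => cosh (a * s)) (a * sinh (a * x)).
Proof.
have h := is_derive_mul (is_derive_add (is_derive_expZ a x)
  (is_derive_expZ (- a) x))
  (is_derive_const (2^-1 : R) x).
rewrite /cosh; under eq_fun do rewrite -mulNr.
by refine (is_derive_eq h _); rewrite sinhE !mulNr; field.
Qed.

Lemma is_derive_sinh (a x : R) :
  is_derive x 1 (fun s => sinh (a * s)) (a * cosh (a * x)).
Proof.
have h := is_derive_mul (is_derive_add (is_derive_expZ a x)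
   (is_derive_mul (is_derive_const (-1 : R) x) (is_derive_expZ (- a) x)))
  (is_derive_const (2^-1 : R) x).
rewrite /sinh; under eq_fun do rewrite -mulNr -[X in _ + X]mulN1r.
by refine (is_derive_eq h _); rewrite /cosh !mulNr; field.
Qed.

Lemma cosh2_sinh2 (x : R) : cosh x ^+ 2 - sinh x ^+ 2 = 1.
Proof.
have e : expR x * expR (- x) = 1 by rewrite -expRD subrr expR0.
by rewrite /cosh /sinh -[RHS]e; field.
Qed.

Lemma cosh0 : cosh 0 = 1.
Proof. by rewrite /cosh oppr0 expR0; field. Qed.
Lemma sinh0 : @sinh R 0 = 0.
Proof. by rewrite /sinh oppr0 subrr mul0r. Qed.

Lemma cosh_gt0 x : 0 < cosh x.
Proof. by rewrite /cosh divr_gt0// addr_gt0// expR_gt0. Qed.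

Lemma sinh_gt0 (x : R) : 0 < x -> 0 < sinh x.
Proof.
by move=> x0; rewrite /sinh divr_gt0// subr_gt0 ltr_expR; lra.
Qed.

(** The functions exp (- e t) (d + e y), for e = w and e = - w, are first
integrals of y' = d, d' = w ^+ 2 * y, and they determine y. *)
Lemma linear_ode (w : R) (y d : R -> R) : w != 0 ->
  (forall t : R, is_derive t 1 y (d t)) ->
  (forall t : R, is_derive t 1 d (w ^+ 2 * y t)) ->
  forall t, y t = cosh (w * t) * y 0 + sinh (w * t) / w * d 0.
Proof.
move=> w0 hy hd t.
have key e : e ^+ 2 = w ^+ 2 ->
    d t + e * y t = expR (e * t) * (d 0 + e * y 0).
  move=> ew.
  pose p (s : R) := expR (- e * s) * (d s + e * y s).
  have hp (s : R) : is_derive s 1 p 0.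
    have h := is_derive_mul (is_derive_expZ (- e) s)
      (is_derive_add (hd s) (is_derive_mul (is_derive_const e s) (hy s))).
    by refine (is_derive_eq h _); rewrite -ew; ring.
  have := derive0_const hp t; rewrite /p mulr0 expR0 mul1r => <-.
  by rewrite mulrA -expRD mulNr subrr expR0 mul1r.
(* The difference of the two first integrals eliminates d. *)
have k1 := key w erefl; have k2 := key (- w) (sqrrN w).
have : 2 * w * y t = expR (w * t) * (d 0 + w * y 0) - expR (- (w * t)) *
  (d 0 - w * y 0).
  have -> : expR (- (w * t)) * (d 0 - w * y 0) =
    d t - w * y t by rewrite -!mulNr k2.
  by rewrite -k1; ring.
move=> h; apply: (mulfI (_ : 2 * w != 0)); first by rewrite mulf_neq0.
by rewrite h /cosh /sinh; field.
Qed.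

(** Rational parametrization of the conic a^2 + p b^2 = 1 near (1, 0), uniform
in the sign of p: it provides curves with a prescribed velocity on the sphere
(p >= 0) and on the hyperboloid (p <= 0). *)
Lemma quadric_curve (p : R) : exists a b : R -> R,
  [/\ \forall s \near (0 : R), a s ^+ 2 + p * b s ^+ 2 = 1,
      a 0 = 1, b 0 = 0, is_derive (0:R) 1 a 0 & is_derive (0:R) 1 b 1].
Proof.
(* The line of slope s / 2 through (-1, 0) meets the conic again at a = (1 + w)
/ (1 - w) and b = s / (1 - w). *)
pose w (s : R) := - (p / 4) * (s * s).
have hw : is_derive (0:R) 1 w 0.
  have h := is_derive_mul (is_derive_const (- (p / 4)) 0)
    (is_derive_mul (is_derive_id (0:R) (1:R)) (is_derive_id (0:R) (1:R))).
  by refine (is_derive_eq h _); ring.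
have w0 : w 0 = 0 by rewrite /w !mulr0.
have hm : is_derive (0:R) 1 (fun s => 1 - w s) 0.
  have h := is_derive_add (is_derive_const (1 : R) 0)
    (is_derive_mul (is_derive_const (-1 : R) 0) hw).
  have -> : (fun s => 1 - w s) = fun s => 1 + -1 * w s.
    by apply/funext => s; rewrite mulN1r.
  by refine (is_derive_eq h _); ring.
have hV : is_derive (0:R) 1 (fun s => (1 - w s)^-1) 0.
  have h := is_deriveV (f := fun s => 1 - w s) (x := 0) _ hm.
  by refine (is_derive_eq (h _) _); rewrite ?scaler0// w0 subr0 oner_neq0.
exists (fun s => (1 + w s) * (1 - w s)^-1), (fun s => s * (1 - w s)^-1).
split.
- have : \forall s \near (0:R), 0 < 1 - w s.
    by apply: (is_derive_near_gt0 hm); rewrite w0 subr0.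
  apply: filterS => s s0.
  have n0 : 1 - w s != 0 by rewrite gt_eqF.
  have ps : p * s ^+ 2 = - 4 * w s by rewrite /w; field.
  rewrite !exprMn [p * _]mulrA ps -mulrDl exprVn.
  have -> : (1 + w s) ^+ 2 + - 4 * w s = (1 - w s) ^+ 2 by ring.
  by rewrite divff// expf_neq0.
- by rewrite w0 addr0 subr0 invr1 mulr1.
- by rewrite mul0r.
- have h := is_derive_mul (is_derive_add (is_derive_const (1 : R) 0) hw) hV.
  by refine (is_derive_eq h _); ring.
- have h := is_derive_mul (is_derive_id (0:R) (1:R)) hV.
  by refine (is_derive_eq h _); rewrite w0 subr0 invr1; ring.
Qed.

End calculus.

(** * Linear algebra in coordinates *)

Section linear_coordinates.
Context {R : realType}.

Lemma linear_delta N (W : lmodType R) (f : 'rV[R]_N -> W) (y : 'rV[R]_N) :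
  linear f -> f y = \sum_i y 0 i *: f (delta_mx 0 i).
Proof.
move=> lf; pose F : {linear 'rV[R]_N -> W} :=
  HB.pack f (GRing.isLinear.Build _ _ _ _ f lf).
rewrite -[LHS]/(F y) [y in LHS]row_sum_delta linear_sum.
by apply: eq_bigr => i _; rewrite linearZ.
Qed.

Lemma mul_delta_images N m (f : 'rV[R]_N -> 'rV[R]_m) (y : 'rV[R]_N) :
  linear f ->
  y *m (\matrix_i f (delta_mx 0 i)) = f y.
Proof.
move=> lf; rewrite (linear_delta y lf) mulmx_sum_row.
by apply: eq_bigr => i _; rewrite rowK.
Qed.

Lemma comp_linear (V1 V2 V3 : lmodType R) (f : V2 -> V3) (g : V1 -> V2) :
  linear f -> linear g -> linear (f \o g).
Proof. by move=> lf lg a y y' /=; rewrite lg lf. Qed.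

Definition unvec m n (y : 'rV[R]_(n * m)) : 'M[R]_(m, n) := (vec_mx y)^T.
(** The transpose makes the length n * m, so that for m = n.+1 it is literally
the dimension n * n.+1 of the two manifolds. *)
Definition vec m n (Y : 'M[R]_(m, n)) : 'rV[R]_(n * m) := mxvec Y^T.

Lemma unvec_linear m n : linear (@unvec m n).
Proof. by move=> a y y'; rewrite /unvec !linearP. Qed.
Lemma vec_linear m n : linear (@vec m n).
Proof. by move=> a Y Y'; rewrite /vec !linearP. Qed.

Lemma vecK m n : cancel (@vec m n) (@unvec m n).
Proof. by move=> Y; rewrite /unvec /vec mxvecK trmxK. Qed.

Lemma dot_unvec m n (y y' : 'rV[R]_(n * m)) :
  \sum_i dot (row i (unvec y)) (row i (unvec y')) = dot y y'.
Proof.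
rewrite -[y in RHS]vec_mxK -[y' in RHS]vec_mxK /dot.
rewrite [RHS](reindex _ (curry_mxvec_bij _ _)) /=.
rewrite exchange_big pair_bigA /=; apply: eq_bigr => -[j i] _ /=.
by rewrite !mxvecE !mxE.
Qed.

End linear_coordinates.

Section determinant.
Context {R : fieldType}.

(** Sylvester's determinant identity, in a form that does not divide by s. Both
sides compute the determinant of the block matrix with rows (1, - b) and (U,
s), once multiplied by a block triangular factor on either side. *)
Lemma det_scalar_addM N m (s : R) (b : 'M[R]_(N, m)) (U : 'M[R]_(m, N)) :
  s ^+ m * \det (s%:M + b *m U) = s ^+ N * \det (s%:M + U *m b).
Proof.
pose X := block_mx 1%:M (- b) U s%:M.
have e1 : X *m block_mx 1%:M b 0 1%:M = block_mx 1%:M 0 U (s%:M + U *m b).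
  rewrite mulmx_block !mulmx1 !mulmx0 !addr0 mul1mx.
  by rewrite subrr [U *m b + _]addrC.
have e2 : block_mx s%:M b 0 1%:M *m X = block_mx (s%:M + b *m U) 0 U s%:M.
  rewrite mulmx_block !mul1mx !mul0mx !add0r mulmx1.
  by rewrite mulmxN mul_scalar_mx mul_mx_scalar addNr.
have := congr1 determinant e2; rewrite det_mulmx det_ublock det_lblock.
rewrite !det_scalar expr1n mulr1.
have := congr1 determinant e1; rewrite det_mulmx det_ublock det_lblock.
by rewrite !det1 !mulr1 mul1r => -> ->; rewrite mulrC.
Qed.

End determinant.

(** * The Euclidean and Minkowski forms *)

Section forms.
Context {R : realType}.

Lemma dotC n (x y : 'rV[R]_n) : dot x y = dot y x.
Proof. by apply: eq_bigr => i _; rewrite mulrC. Qed.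

Lemma dotDl n (x y z : 'rV[R]_n) : dot (x + y) z = dot x z + dot y z.
Proof. by rewrite -big_split; apply: eq_bigr => i _; rewrite mxE mulrDl. Qed.

Lemma dotZl n a (x z : 'rV[R]_n) : dot (a *: x) z = a * dot x z.
Proof. by rewrite /dot mulr_sumr; apply: eq_bigr => i _; rewrite mxE mulrA. Qed.

Lemma dotDr n (x y z : 'rV[R]_n) : dot z (x + y) = dot z x + dot z y.
Proof. by rewrite dotC dotDl !(dotC z). Qed.

Lemma dotZr n a (x z : 'rV[R]_n) : dot z (a *: x) = a * dot z x.
Proof. by rewrite dotC dotZl (dotC z). Qed.

Lemma minkE n (x y : 'rV[R]_n.+1) : mink x y =
  dot x y - 2 * (x 0 ord0 * y 0 ord0).
Proof. by rewrite /mink /dot big_ord_recl; ring. Qed.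

Lemma minkC n (x y : 'rV[R]_n.+1) : mink x y = mink y x.
Proof. by rewrite !minkE dotC mulrC (mulrC (x 0 ord0)) mulrC. Qed.

Lemma minkDl n (x y z : 'rV[R]_n.+1) : mink (x + y) z = mink x z + mink y z.
Proof. by rewrite !minkE dotDl mxE; ring. Qed.

Lemma minkZl n a (x z : 'rV[R]_n.+1) : mink (a *: x) z = a * mink x z.
Proof. by rewrite !minkE dotZl mxE; ring. Qed.

Lemma minkDr n (x y z : 'rV[R]_n.+1) : mink z (x + y) = mink z x + mink z y.
Proof. by rewrite minkC minkDl !(minkC z). Qed.

Lemma minkZr n a (x z : 'rV[R]_n.+1) : mink z (a *: x) = a * mink z x.
Proof. by rewrite minkC minkZl (minkC z). Qed.

Lemma mink0l n (z : 'rV[R]_n.+1) : mink 0 z = 0.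
Proof. by rewrite -(scale0r 0) minkZl mul0r. Qed.

Lemma minkNl n (x z : 'rV[R]_n.+1) : mink (- x) z = - mink x z.
Proof. by rewrite -scaleN1r minkZl mulN1r. Qed.

Lemma minkNr n (x z : 'rV[R]_n.+1) : mink z (- x) = - mink z x.
Proof. by rewrite minkC minkNl minkC. Qed.

Lemma mink_suml n m (f : 'I_m -> 'rV[R]_n.+1) z :
  mink (\sum_i f i) z = \sum_i mink (f i) z.
Proof.
apply: (big_morph (fun x => mink x z)); last exact: mink0l.
by move=> x y; exact: minkDl.
Qed.

(** The form is indefinite, so a vector is identified by its products with all
vectors and not by mink a a = 0. *)
Lemma mink_nondegenerate n (a : 'rV[R]_n.+1) : (forall w, mink a w = 0) -> a =
  0.
Proof.
move=> h; apply/rowP => i; rewrite mxE.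
have := h (delta_mx 0 i); rewrite minkE /dot (bigD1 i)//= !mxE !eqxx mulr1.
rewrite big1 ?addr0; last by move=> j ji; rewrite mxE eqxx (negPf ji) mulr0.
by case: eqVneq => [->|_] /=; rewrite ?mulr1 ?mulr0 => e; lra.
Qed.

Lemma is_derive_dot n (f g : R -> 'rV[R]_n) (x : R) df dg :
  is_derive x 1 f df -> is_derive x 1 g dg ->
  is_derive x 1 (fun s => dot (f s) (g s)) (dot df (g x) + dot (f x) dg).
Proof.
move=> /is_derive_mxP hf /is_derive_mxP hg; rewrite /dot -big_split /=.
by apply: is_derive_bigsum => l; exact: is_derive_mul.
Qed.

Lemma is_derive_mink n (f g : R -> 'rV[R]_n.+1) (x : R) df dg :
  is_derive x 1 f df -> is_derive x 1 g dg ->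
  is_derive x 1 (fun s => mink (f s) (g s)) (mink df (g x) + mink (f x) dg).
Proof.
move=> hf hg; under eq_fun do rewrite minkE -mulNr.
have /is_derive_mxP hf0 := hf; have /is_derive_mxP hg0 := hg.
have h := is_derive_add (is_derive_dot hf hg) (is_derive_mul
  (is_derive_const (-2 : R) x) (is_derive_mul (hf0 0 ord0) (hg0 0 ord0))).
by refine (is_derive_eq h _); rewrite !minkE; ring.
Qed.

Lemma mink_mulmxl m n (a : 'rV[R]_m) (G : 'M[R]_(m, n.+1)) (w : 'rV[R]_n.+1) :
  mink (a *m G) w = \sum_i a 0 i * mink (row i G) w.
Proof.
by rewrite mulmx_sum_row mink_suml; apply: eq_bigr => i _; rewrite minkZl.
Qed.

Lemma dot_delta N (y : 'rV[R]_N) i : dot y (delta_mx 0 i) = y 0 i.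
Proof.
rewrite /dot (bigD1 i)//= mxE !eqxx mulr1 big1 ?addr0// => j ji.
by rewrite mxE eqxx (negPf ji) mulr0.
Qed.

End forms.

(** * Tangent spaces of the sphere and of the hyperboloid *)

Section tangent_spaces.
Context {R : realType}.

(** A curve on the sphere with velocity v is obtained from the conic a^2 + (v .
v) b^2 = 1 in the plane spanned by t and v. *)
Lemma tangent_sphereP n (t v : 'rV[R]_n) : unit_sphere t ->
  tangent (@unit_sphere R n) t v <-> dot t v = 0.
Proof.
move=> ht; split=> [[c [hc c0 dc]]|tv].
  have h := is_derive_dot dc dc.
  have := near_const_derive h hc; rewrite c0 (dotC v) => e; lra.
have [a [b [hab a0 b0 da db]]] := quadric_curve (dot v v).
exists (fun s => a s *: t + b s *: v); split.
- apply: filterS hab => s hs.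
  rewrite /unit_sphere /= dotDl !dotDr !dotZl !dotZr (dotC v t) tv.
  have ht' : dot t t = 1 by [].
  by rewrite ht' -[RHS]hs; ring.
- by rewrite a0 b0 scale1r scale0r addr0.
- have h := is_derive_add (is_derive_scale da (is_derive_const t 0))
    (is_derive_scale db (is_derive_const v 0)).
  by refine (is_derive_eq h _); rewrite scale0r !scaler0 scale1r !addr0 add0r.
Qed.

(** As for the sphere, with the conic a^2 - k^2 (v . v) b^2 = 1; continuity
keeps the curve on the upper sheet. *)
Lemma tangent_hyperbolicP k n (z v : 'rV[R]_n.+1) : 0 < k -> hyperbolic k z ->
  tangent (@hyperbolic R k n) z v <-> mink z v = 0.
Proof.
move=> k0 [hz z0]; have k1 : k != 0 by rewrite gt_eqF.
split=> [[c [hc c0 dc]]|tv].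
  have h := is_derive_mink dc dc.
  have hc' : \forall s \near (0:R), mink (c s) (c s) = - k ^- 2.
    by apply: filterS hc => s [].
  have := near_const_derive h hc'; rewrite c0 (minkC v) => e; lra.
have [a [b [hab a0 b0 da db]]] := quadric_curve (- (k ^+ 2 * mink v v)).
pose c s := a s *: z + b s *: v.
have c0 : c 0 = z by rewrite /c a0 b0 scale1r scale0r addr0.
have dc : is_derive (0:R) 1 c v.
  have h := is_derive_add (is_derive_scale da (is_derive_const z 0))
    (is_derive_scale db (is_derive_const v 0)).
  by refine (is_derive_eq h _); rewrite scale0r !scaler0 scale1r !addr0 add0r.
exists c; split=> //.
have pos : \forall s \near (0:R), 0 < c s 0 ord0.
  have /is_derive_mxP/(_ 0 ord0) dc0 := dc.
  by apply: (is_derive_near_gt0 dc0); rewrite c0.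
near=> s; split; last by near: s.
have hs : a s ^+ 2 + - (k ^+ 2 * mink v v) * b s ^+ 2 = 1 by near: s.
rewrite /c minkDl !minkDr !minkZl !minkZr (minkC v z) tv hz.
by rewrite -[RHS]mulr1 -hs; field.
Unshelve. all: by end_near. Qed.

End tangent_spaces.

(** * Geodesics of the hyperboloid *)

Section geodesics.
Context {R : realType}.

(** The normal line at z is spanned by z, as mink z z is not zero. *)
Lemma hyperbolic_normal (k : R) n (z a : 'rV[R]_n.+1) : 0 < k ->
  hyperbolic k z ->
  (forall w, mink z w = 0 -> mink a w = 0) -> a = (- k ^+ 2 * mink a z) *: z.
Proof.
move=> k0 [hz _] ha; have k1 : k != 0 by rewrite gt_eqF.
apply/eqP; rewrite -subr_eq0; apply/eqP; apply: mink_nondegenerate => w.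
(* The orthogonal projection of w to the tangent space at z. *)
pose w' := w + (k ^+ 2 * mink z w) *: z.
have zw' : mink z w' = 0 by rewrite minkDr minkZr hz; field.
have aw : mink a w = - (k ^+ 2 * mink z w * mink a z).
  have := ha _ zw'; rewrite minkDr minkZr => /(canRL (addrK _)).
  by rewrite sub0r.
by rewrite minkDl minkNl minkZl aw; ring.
Qed.

Variables (k r : R) (n : nat) (z v : 'rV[R]_n.+1).
Hypotheses (k0 : 0 < k) (r0 : 0 < r) (hz : hyperbolic k z).
Hypotheses (zv : mink z v = 0) (vv : mink v v = r ^+ 2).

Let k1 : k != 0. Proof. by rewrite gt_eqF. Qed.
Let r1 : r != 0. Proof. by rewrite gt_eqF. Qed.
Let w := k * r.
Let w1 : w != 0. Proof. by rewrite mulf_neq0. Qed.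

Definition hyperbola (t : R) : 'rV[R]_n.+1 :=
  cosh (w * t) *: z + (sinh (w * t) / w) *: v.
Definition hyperbola' (t : R) : 'rV[R]_n.+1 :=
  (w * sinh (w * t)) *: z + cosh (w * t) *: v.

Lemma is_derive_hyperbola (t : R) : is_derive t 1 hyperbola (hyperbola' t).
Proof.
have h := is_derive_add (is_derive_scale (is_derive_cosh w t)
  (is_derive_const z t))
  (is_derive_scale (is_derive_mul (is_derive_sinh w t)
     (is_derive_const (w^-1 : R) t)) (is_derive_const v t)).
refine (is_derive_eq h _); rewrite !scaler0 !addr0 mulr0 addr0.
by congr (_ + _ *: _); field.
Qed.

Lemma is_derive_hyperbola' (t : R) : is_derive t 1 hyperbola'
  (w ^+ 2 *: hyperbola t).
Proof.
have h := is_derive_add (is_derive_scale (is_derive_mul (is_derive_const w t)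
   (is_derive_sinh w t)) (is_derive_const z t))
  (is_derive_scale (is_derive_cosh w t) (is_derive_const v t)).
refine (is_derive_eq h _); rewrite !scaler0 !addr0 mul0r add0r scalerDr
  !scalerA.
by congr (_ *: _ + _ *: _); field.
Qed.

Lemma hyperbola0 : hyperbola 0 = z.
Proof. by rewrite /hyperbola mulr0 cosh0 sinh0 mul0r scale0r scale1r addr0. Qed.

Lemma hyperbola'0 : hyperbola' 0 = v.
Proof. by rewrite /hyperbola' mulr0 cosh0 sinh0 mulr0 scale0r scale1r add0r.
  Qed.

Lemma hyperbola_quadric t : mink (hyperbola t) (hyperbola t) = - k ^- 2.
Proof.
have [hz1 _] := hz.
rewrite /hyperbola minkDl !minkDr !minkZl !minkZr (minkC v z) zv vv hz1.
rewrite -[RHS]mulr1 -(cosh2_sinh2 (w * t)) /w; field.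
by rewrite k1 r1.
Qed.

(** The first coordinate cannot vanish on the quadric, where mink would be a
sum of squares, so by the intermediate value theorem it keeps its sign. *)
Lemma hyperbola_hyperbolic t : hyperbolic k (hyperbola t).
Proof.
split; first exact: hyperbola_quadric.
pose f s := hyperbola s 0 ord0.
have cf : continuous f.
  move=> s; have /is_derive_mxP h := is_derive_hyperbola s.
  exact: is_derive_continuous (h 0 ord0).
have f1 s : f s != 0.
  apply/eqP => fs; have := hyperbola_quadric s.
  rewrite /mink -/(f s) fs mul0r oppr0 add0r => e.
  have : 0 <= - k ^- 2 :> R by rewrite -e; apply: sumr_ge0 => i _;
    rewrite -expr2 sqr_ge0.
  by rewrite oppr_ge0 leNgt invr_gt0 exprn_gt0.
have f0 : 0 < f 0 by rewrite /f hyperbola0; case: hz.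
rewrite -/(f t) ltNge; apply/negP => ft.
have [c] : exists c, f c = 0.
  have [t0|t0] := leP 0 t.
    have := @IVT R f 0 t 0 t0 (continuous_subspaceT cf).
    by rewrite ge_min le_max ft (ltW f0) orbT; case=> // c _ fc; exists c.
  have := @IVT R f t 0 0 (ltW t0) (continuous_subspaceT cf).
  by rewrite ge_min le_max ft (ltW f0) orbT; case=> // c _ fc; exists c.
by move/eqP; rewrite (negPf (f1 c)).
Qed.

Lemma derive1_hyperbola : derive1 hyperbola = hyperbola'.
Proof.
by apply/funext => t; rewrite derive1E; have [_ ->] := is_derive_hyperbola t.
Qed.

Lemma hyperbola_geodesic : is_geodesic (@mink R n) (@hyperbolic R k n)
  hyperbola.
Proof.
split.
- exact: hyperbola_hyperbolic.
- by move=> t; have [] := is_derive_hyperbola t.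
- by rewrite derive1_hyperbola => t; have [] := is_derive_hyperbola' t.
move=> t u; rewrite derive1_hyperbola derive1E.
have [_ ->] := is_derive_hyperbola' t.
move/(tangent_hyperbolicP _ k0 (hyperbola_hyperbolic t)) => e.
by rewrite minkZl e mulr0.
Qed.

(** The acceleration is normal, hence a multiple of c. The factor is k^2 times
the squared speed, which is constant because the acceleration is orthogonal to
the velocity; so the coordinates of c solve a linear equation. *)
Lemma geodesic_hyperbola (c : R -> 'rV[R]_n.+1) :
  is_geodesic (@mink R n) (@hyperbolic R k n) c -> c 0 = z -> derive1 c 0 = v ->
  c = hyperbola.
Proof.
move=> [Hc dc ddc cN] c0 c'0.
pose D1 := derive1 c; pose D2 := derive1 D1.
have h1 (t : R) : is_derive t 1 c (D1 t) by rewrite /D1 derive1E;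
  exact/derivableP/dc.
have h2 (t : R) : is_derive t 1 D1 (D2 t) by rewrite /D2 derive1E;
  exact/derivableP/ddc.
have cD1 t : mink (c t) (D1 t) = 0.
  have h := is_derive_mink (h1 t) (h1 t).
  have := near_const_derive (a := - k ^- 2) h.
  rewrite (minkC (D1 t)) => e; suff : mink (c t) (D1 t) + mink (c t) (D1 t) =
    0 by lra.
  by apply: e; near=> s; have [] := Hc s.
have cD2 t : mink (D1 t) (D1 t) + mink (c t) (D2 t) = 0.
  have h := is_derive_mink (h1 t) (h2 t).
  by apply: (near_const_derive (a := 0) h); near=> s.
have D2E t : D2 t = (k ^+ 2 * mink (D1 t) (D1 t)) *: c t.
  rewrite {1}(hyperbolic_normal k0 (Hc t) (a := D2 t)).
    have -> : mink (D1 t) (D1 t) = - mink (c t) (D2 t) by have := cD2 t; lra.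
    by rewrite minkC mulrN mulNr.
  by move=> u /(tangent_hyperbolicP _ k0 (Hc t)); exact: cN.
have energy t : mink (D1 t) (D1 t) = r ^+ 2.
  rewrite -vv -c'0; apply: (derive0_const (f := fun t => mink (D1 t) (D1 t)))
    => s.
  have h := is_derive_mink (h2 s) (h2 s).
  by refine (is_derive_eq h _); rewrite D2E minkZl minkZr (minkC (D1 s)) cD1
    !mulr0 addr0.
have D2E' t : D2 t = w ^+ 2 *: c t by rewrite D2E energy exprMn.
apply/funext => t; apply/rowP => j.
have hy (s : R) : is_derive s 1 (fun s => c s 0 j) (D1 s 0 j).
  by have /is_derive_mxP := h1 s.
have hd (s : R) : is_derive s 1 (fun s => D1 s 0 j) (w ^+ 2 * c s 0 j).
  by have /is_derive_mxP/(_ 0 j) := h2 s; rewrite D2E' mxE.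
have -> := linear_ode w1 hy hd t.
by rewrite c0 /D1 c'0 !mxE.
Unshelve. all: by end_near. Qed.

Lemma exp_map_hyperbolic :
  exp_map (@mink R n) (@hyperbolic R k n) z v =
  cosh (k * r) *: z + (sinh (k * r) / (k * r)) *: v.
Proof.
rewrite /exp_map; apply: xget_unique.
  exists hyperbola; split.
  - exact: hyperbola_geodesic.
  - exact: hyperbola0.
  - by rewrite derive1_hyperbola hyperbola'0.
  - by rewrite /hyperbola mulr1.
move=> y [c [gc c0 c'0 <-]].
by rewrite (geodesic_hyperbola gc c0 c'0) /hyperbola mulr1.
Qed.

End geodesics.

(** * Jacobian determinants in isometric coordinates *)

Section jacobian_coordinates.
Context {R : realType}.
Variables (W W' : normedModType R) (N : nat) (g : W -> W -> R) (M : set W).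
Variables (g' : W' -> W' -> R) (M' : set W') (F : W -> W') (p : W).
Variables (phi : 'rV[R]_N -> W) (psi : 'rV[R]_N -> W') (L : 'M[R]_N).
Hypotheses (lphi : linear phi) (lpsi : linear psi).
Hypothesis tphi : forall v, tangent M p v <-> exists y, v = phi y.
Hypothesis tpsi : forall v, tangent M' (F p) v <-> exists y, v = psi y.
Hypothesis gphi : forall x y, g (phi x) (phi y) = dot x y.
Hypothesis gpsi : forall x y, g' (psi x) (psi y) = dot x y.
Hypothesis dF : forall y, is_differential M F p (phi y) (psi (y *m L)).

(** In isometric coordinates phi and psi an orthonormal basis is an orthogonal
matrix. So if L is the matrix of the differential in these coordinates, the
matrix A of any other choice of bases satisfies A *m X' = X *m L with X and X'
orthogonal, and the determinants of A and L agree up to sign. *)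
Lemma jacobian_coordinates :
  is_jacobian_det N g M g' M' F p (\det L) /\
  forall J, is_jacobian_det N g M g' M' F p J -> `|J| = `|\det L|.
Proof.
split.
  exists (fun i => phi (delta_mx 0 i)), (fun i => psi (delta_mx 0 i)), L;
    split=> //.
  - split.
    + by move=> i; apply/tphi; eexists.
    + by move=> i j; rewrite gphi dot_delta mxE eqxx eq_sym.
    + by move=> v /tphi[y ->]; exists (y 0); exact: linear_delta.
  - split.
    + by move=> i; apply/tpsi; eexists.
    + by move=> i j; rewrite gpsi dot_delta mxE eqxx eq_sym.
    + by move=> v /tpsi[y ->]; exists (y 0); exact: linear_delta.
  move=> i; have := @dF (delta_mx 0 i); rewrite (linear_delta _ lpsi).
  by rewrite -rowE; under eq_bigr do rewrite mxE.
move=> J [e [e' [A [[te ge _] [te' ge' _] hA ->]]]].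
have /choice[y ye] : forall i, exists y, e i = phi y by move=> i; exact/tphi.
have /choice[y' ye'] : forall i, exists y, e' i = psi y by move=> i; exact/tpsi.
have orth (x : 'I_N -> 'rV[R]_N) : (forall i j, dot (x i) (x j) = (i == j)%:R)
  ->
    `|\det (\matrix_i x i)| = 1.
  move=> h; have : (\matrix_i x i) *m (\matrix_i x i)^T = 1%:M.
    apply/matrixP => i j; rewrite !mxE -h; apply: eq_bigr => l _.
    by rewrite !mxE.
  move/(congr1 determinant); rewrite det_mulmx det_tr det1 -expr2 => /eqP.
  by rewrite sqrf_eq1 => /orP[] /eqP ->; rewrite ?normrN normr1.
have X1 : `|\det (\matrix_i y i)| = 1.
  by apply: orth => i j; rewrite -gphi -!ye.
have X2 : `|\det (\matrix_i y' i)| = 1.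
  by apply: orth => i j; rewrite -gpsi -!ye'.
suff E : A *m (\matrix_i y' i) = (\matrix_i y i) *m L.
  have := congr1 (fun B => `|\det B|) E.
  by rewrite !det_mulmx !normrM X1 X2 mulr1 mul1r.
apply/row_matrixP => i; rewrite !row_mul rowK.
(* An isometry of a nondegenerate form is injective. *)
have inj (a b : 'rV[R]_N) : psi a = psi b -> a = b.
  by move=> ab; apply/rowP => j; rewrite -!dot_delta -!gpsi ab.
apply: inj.
have [c hc] := te i.
have h1 := hA i c hc.
have h2 := @dF (y i); rewrite -ye in h2; have {}h2 := h2 c hc.
rewrite -(is_derive_unique h1 h2) mulmx_sum_row.
pose P : {linear 'rV[R]_N -> W'} := HB.pack psi
  (GRing.isLinear.Build _ _ _ _ psi lpsi).
rewrite -[LHS]/(P _) linear_sum; apply: eq_bigr => j _.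
by rewrite linearZ /= ye' rowK mxE.
Qed.

End jacobian_coordinates.

(** * Tangent spaces of products *)

Section products.
Context {R : realType}.

Lemma is_derive_cvg (W : normedModType R) (f : R -> W) (x : R) (df : W) :
  is_derive x 1 f df <->
  (fun h : R => h^-1 *: (f (h *: 1 + x) - f x)) @ 0^' --> df.
Proof.
split=> [[fx <-]|h]; first exact: fx.
by apply: DeriveDef; [apply/cvg_ex; exists df|exact/cvg_lim].
Qed.

Lemma is_derive_pair (W W' : normedModType R) (f : R -> W) (f' : R -> W')
    (x : R) (df : W) (df' : W') :
  is_derive x 1 f df -> is_derive x 1 f' df' ->
  is_derive x 1 (fun s => (f s, f' s)) (df, df').
Proof.
move=> /is_derive_cvg h /is_derive_cvg h'; apply/is_derive_cvg.
exact: (cvg_pair h h').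
Qed.

Lemma is_derive_fst (W W' : normedModType R) (f : R -> (W * W')%type) (x : R)
  df :
  is_derive x 1 f df -> is_derive x 1 (fun s => (f s).1) df.1.
Proof.
move=> /is_derive_cvg h; apply/is_derive_cvg.
exact: (cvg_comp _ _ h (@cvg_fst _ _ (nbhs df.1) (nbhs df.2) _)).
Qed.

Lemma is_derive_snd (W W' : normedModType R) (f : R -> (W * W')%type) (x : R)
  df :
  is_derive x 1 f df -> is_derive x 1 (fun s => (f s).2) df.2.
Proof.
move=> /is_derive_cvg h; apply/is_derive_cvg.
exact: (cvg_comp _ _ h (@cvg_snd _ _ (nbhs df.1) (nbhs df.2) _)).
Qed.

Lemma is_derive_comp_diff (U W : normedModType R) (f : U -> W) (c : R -> U)
    (x : R) dc : differentiable f (c x) -> is_derive x 1 c dc ->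
  is_derive x 1 (fun s => f (c s)) ('d f (c x) dc).
Proof.
move=> hf [hc <-]; have hc' : differentiable c x by exact/derivable1_diffP.
have hfc : differentiable (f \o c) x by exact: differentiable_comp.
apply: DeriveDef; first exact/derivable1_diffP.
by rewrite !deriveE// diff_comp.
Qed.

Lemma tangent_pow m n (M : set 'rV[R]_n) (X V : 'M[R]_(m, n)) :
  tangent (pow_set (m := m) M) X V <-> forall i, tangent M (row i X) (row i V).
Proof.
split=> [[c [hc c0 dc]] i|h].
  exists (fun s => row i (c s)); split; last exact: is_derive_row.
    by apply: filterS hc => s; apply.
  by rewrite c0.
have /choice[c hc] := h.
pose C (s : R) : 'M[R]_(m, n) := \matrix_i c i s.
exists C; split.
- rewrite /C /pow_set /=; near=> s => i; rewrite rowK.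
  move: i; near: s; apply: filter_forall => i.
  by have [] := hc i.
- by apply/row_matrixP => i; rewrite rowK; have [] := hc i.
- apply: is_derive_rows => i; have [_ _] := hc i.
  by rewrite /C; under [in X in _ -> X]eq_fun do rewrite rowK.
Unshelve. all: by end_near. Qed.

(** The factor ]0, +oo[ is open in R and imposes no condition. *)
Lemma tangent_source (k : R) n (p v : source_type R n) : 0 < p.1.1 ->
  tangent (source k (n := n)) p v <->
  tangent (@hyperbolic R k n) p.1.2 v.1.2 /\
  tangent (pow_set (m := n.+1) (@unit_sphere R n)) p.2 v.2.
Proof.
move=> p0; split=> [[c [hc c0 dc]]|[[a [ha a0 da]] [b [hb b0 db]]]].
  split.
    exists (fun s => (c s).1.2); split; last exact/is_derive_snd/is_derive_fst.
      by apply: filterS hc => s [].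
    by rewrite c0.
  exists (fun s => (c s).2); split; last exact/is_derive_snd.
    by apply: filterS hc => s [].
  by rewrite c0.
have dr : is_derive (0:R) 1 (fun s => p.1.1 + s * v.1.1) v.1.1.
  have h := is_derive_add (is_derive_const p.1.1 0)
    (is_derive_mul (is_derive_id (0:R) (1:R)) (is_derive_const v.1.1 0)).
  by refine (is_derive_eq h _); rewrite mulr0 addr0 mul1r add0r.
exists (fun s : R => (p.1.1 + s * v.1.1, a s, b s)); split.
- near=> s; split; [|by near: s..].
  by near: s; apply: (is_derive_near_gt0 dr); rewrite mul0r addr0.
- by rewrite mul0r addr0 a0 b0; case: (p) => -[].
- have := is_derive_pair (is_derive_pair dr da) db.
  by case: (v) => -[].
Unshelve. all: by end_near. Qed.

End products.

(** * The Jacobian of the change of variables *)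

Section change_of_variables.
Context {R : realType}.
Variables (k : R) (n : nat) (E : 'rV[R]_n.+1 -> 'M[R]_(n, n.+1)).
Hypotheses (k0 : 0 < k) (hE : is_orthonormal_frame k E).

Let k1 : k != 0. Proof. by rewrite gt_eqF. Qed.

Lemma frame_normal (z : 'rV[R]_n.+1) (a : 'rV[R]_n) : hyperbolic k z ->
  mink (a *m E z) z = 0.
Proof.
move=> hz; have [_ [te _ _]] := hE hz.
rewrite mink_mulmxl big1// => i _; rewrite minkC.
by have /(tangent_hyperbolicP _ k0 hz) -> := te i; rewrite mulr0.
Qed.

Lemma frame_isometry (z : 'rV[R]_n.+1) (a b : 'rV[R]_n) : hyperbolic k z ->
  mink (a *m E z) (b *m E z) = dot a b.
Proof.
move=> hz; have [_ [_ ge _]] := hE hz.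
rewrite mink_mulmxl; apply: eq_bigr => i _; rewrite minkC mink_mulmxl.
rewrite (bigD1 i)//= ge eqxx mulr1 big1 ?addr0// => j ji.
by rewrite ge (negPf ji) mulr0.
Qed.

Lemma frame_span (z v : 'rV[R]_n.+1) : hyperbolic k z -> mink z v = 0 ->
  exists a : 'rV[R]_n, v = a *m E z.
Proof.
move=> hz /(tangent_hyperbolicP _ k0 hz) tv; have [_ [_ _ sp]] := hE hz.
have [a ->] := sp _ tv; exists (\row_i a i).
by rewrite mulmx_sum_row; apply: eq_bigr => i _; rewrite mxE.
Qed.

(** The line of z and the tangent space at z span the ambient space. *)
Lemma frame_decomposition (z w : 'rV[R]_n.+1) : hyperbolic k z ->
  exists (l : R) (b : 'rV[R]_n), w = l *: z + b *m E z.
Proof.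
move=> hz; have [hz1 _] := hz.
have [|b hb] := @frame_span z (w + (k ^+ 2 * mink w z) *: z) hz.
  by rewrite minkDr minkZr hz1 (minkC z); field.
by exists (- (k ^+ 2 * mink w z)), b; rewrite -hb scaleNr addrC addrK.
Qed.

(** The homogeneity of the exponential formula: the velocity r u has norm r. *)
Lemma change_varE (p : source_type R n) i : source k p ->
  row i (change_var k E p) = cosh (k * p.1.1) *: p.1.2 +
    (sinh (k * p.1.1) / k) *: (row i p.2 *m E p.1.2).
Proof.
move: p => [[r z] t] [/= r0 hz ht]; rewrite rowK /= row_mul.
have r1 : r != 0 by rewrite gt_eqF.
rewrite (@exp_map_hyperbolic _ k r n _ _ k0 r0 hz).
- by rewrite scalerA; congr (_ + _ *: _); field; rewrite k1 r1.
- by rewrite minkZr minkC frame_normal// mulr0.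
- rewrite minkZl minkZr frame_isometry//.
  by have := ht i; rewrite /unit_sphere /= => ->; rewrite mulr1.
Qed.

Variables (r : R) (z : 'rV[R]_n.+1) (t : 'M[R]_(n.+1, n)).
Hypotheses (r0 : 0 < r) (hz : hyperbolic k z).
Hypothesis ht : forall i, unit_sphere (row i t).

Let p : source_type R n := (r, z, t).
Let C := cosh (k * r).
Let S : R := sinh (k * r).
Let s := S / k.
Let u i := row i t *m E z.
Let tt i : dot (row i t) (row i t) = 1. Proof. exact: ht. Qed.
Let zz : mink z z = - k ^- 2. Proof. by case: hz. Qed.
Let CS : C ^+ 2 - S ^+ 2 = 1. Proof. exact: cosh2_sinh2. Qed.
Let C0 : C != 0. Proof. by rewrite gt_eqF// cosh_gt0. Qed.
Let zE a : mink z (a *m E z) = 0. Proof. by rewrite minkC frame_normal. Qed.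
Let Ez a : mink (a *m E z) z = 0. Proof. by rewrite frame_normal. Qed.
Let EE a b : mink (a *m E z) (b *m E z) = dot a b.
Proof. exact: frame_isometry. Qed.

Let x i := C *: z + s *: u i.
Let gam i := (k * S) *: z + C *: u i.

Lemma row_change_var i : row i (change_var k E p) = x i.
Proof. exact: change_varE. Qed.

Definition radial (Y : 'M[R]_(n.+1, n)) : 'rV[R]_n.+1 :=
  \row_i dot (row i Y) (row i t).

(** There are as many radial components as there are dimensions in the factor
]0, +oo[ x H_k^n: the first one is the variation of r, the others are the
coordinates of the variation of z in the frame E z. The rest of Y is the
variation of t, whose rows are orthogonal to those of t. *)
Definition source_coord (Y : 'M[R]_(n.+1, n)) : source_type R n :=
  (radial Y 0 ord0, (\row_j radial Y 0 (lift ord0 j)) *m E z,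
   \matrix_(i, j) (Y i j - radial Y 0 i * t i j)).

(** Parallel transport from z to x_i along their geodesic, read in the frame E
z: it sends u_i to the velocity gam_i at x_i and fixes the vectors that are
orthogonal to z and to u_i. *)
Definition geodesic_transport i (y : 'rV[R]_n) : 'rV[R]_n.+1 :=
  y *m E z + dot y (row i t) *: (gam i - u i).

Definition target_coord (Y : 'M[R]_(n.+1, n)) : 'M[R]_n.+1 :=
  \matrix_i geodesic_transport i (row i Y).

Lemma radial_linear : linear radial.
Proof.
move=> a Y Y'; apply/rowP => i; rewrite !mxE linearP /=.
by rewrite dotDl dotZl.
Qed.

Lemma source_coord_linear : linear source_coord.
Proof.
move=> a Y Y'; rewrite /source_coord radial_linear.
congr (_, _, _).
- by rewrite !mxE.
- transitivity (a *: ((\row_j radial Y 0 (lift ord0 j)) *m E z) +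
      (\row_j radial Y' 0 (lift ord0 j)) *m E z); last by [].
  rewrite scalemxAl -mulmxDl; congr (_ *m _).
  by apply/rowP => j; rewrite !mxE.
- apply/matrixP => i j; transitivity (a * (Y i j - radial Y 0 i * t i j) +
    (Y' i j - radial Y' 0 i * t i j)); last by rewrite !mxE.
  by rewrite !mxE; ring.
Qed.

Lemma geodesic_transport_linear i : linear (geodesic_transport i).
Proof.
move=> a y y'; rewrite /geodesic_transport mulmxDl -scalemxAl.
move: (gam i - u i) => G; rewrite dotDl dotZl scalerDl scalerDr !scalerA.
by rewrite !addrA; congr (_ + _); rewrite addrAC.
Qed.

Lemma target_coord_linear : linear target_coord.
Proof.
move=> a Y Y'; apply/row_matrixP => i.
by rewrite linearP /= !rowK linearP geodesic_transport_linear.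
Qed.

Lemma row_tangential (Y : 'M[R]_(n.+1, n)) i :
  row i (source_coord Y).2 = row i Y + (- radial Y 0 i) *: row i t.
Proof. by apply/rowP => j; rewrite !mxE mulNr. Qed.

(** The rows of Y split orthogonally into their radial components, collected by
the first two factors, and the variations of the t_i. *)
Lemma source_coord_isometry Y Y' :
  source_form (source_coord Y) (source_coord Y') =
  \sum_i dot (row i Y) (row i Y').
Proof.
rewrite /source_form /= EE /pow_form.
transitivity (\sum_i radial Y 0 i * radial Y' 0 i +
  \sum_i (dot (row i Y) (row i Y') - radial Y 0 i * radial Y' 0 i)).
  congr (_ + _); last first.
    apply: eq_bigr => i _; rewrite !row_tangential.
    rewrite dotDl !dotDr !dotZl !dotZr tt (dotC (row i t)).
    by rewrite !mxE; ring.
  rewrite big_ord_recl; congr (_ + _); apply: eq_bigr => i _.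
  by rewrite !mxE.
by rewrite -big_split; apply: eq_bigr => i _ /=; rewrite addrC subrK.
Qed.

Lemma source_coordP v : tangent (source k (n := n)) p v <->
  exists Y, v = source_coord Y.
Proof.
split.
  move/(@tangent_source _ k n p v r0) => [/(tangent_hyperbolicP _ k0 hz) zv].
  move/tangent_pow => tv.
  have tv' i : dot (row i t) (row i v.2) = 0.
    by apply/tangent_sphereP; [exact: ht|exact: tv].
  have [a va] := frame_span hz zv.
  pose b := row_mx (v.1.1%:M : 'M[R]_1) a : 'rV[R]_n.+1.
  exists (\matrix_(i, j) (v.2 i j + b 0 i * t i j)).
  have rb : radial (\matrix_(i, j) (v.2 i j + b 0 i * t i j)) = b.
    apply/rowP => i; rewrite mxE.
    have -> : row i (\matrix_(i, j) (v.2 i j + b 0 i * t i j)) =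
       row i v.2 + b 0 i *: row i t by apply/rowP => j; rewrite !mxE.
    by rewrite dotDl dotZl tt dotC tv' add0r mulr1.
  rewrite /source_coord rb.
  have -> : b 0 ord0 = v.1.1 by exact: row_cons0.
  have -> : \row_j b 0 (lift ord0 j) = a.
    by apply/rowP => j; rewrite mxE; exact: row_consS.
  rewrite -va; have -> : \matrix_(i, j)
    ((\matrix_(i0, j0) (v.2 i0 j0 + b 0 i0 * t i0 j0)) i j
     - b 0 i * t i j) = v.2 by apply/matrixP => i j; rewrite !mxE addrK.
  by case: (v) => -[].
move=> [Y ->]; apply/(@tangent_source _ k n p _ r0); split=> /=.
  by apply/(tangent_hyperbolicP _ k0 hz).
apply/tangent_pow => i; apply/tangent_sphereP; first exact: ht.
have /= -> := row_tangential Y i.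
by rewrite dotDr dotZr tt mxE mulr1 dotC subrr.
Qed.

Lemma mink_gam i : mink (gam i) (gam i) = 1.
Proof.
rewrite /gam minkDl !minkDr !minkZl !minkZr zE Ez EE tt zz -[RHS]CS.
by field.
Qed.

Lemma mink_frame_gam i a : mink (a *m E z) (gam i) = C * dot a (row i t).
Proof. by rewrite /gam minkDr !minkZr Ez EE mulr0 add0r. Qed.

(** The vector gam_i - u_i is the defect of parallel transport from the
identity. *)
Lemma mink_frame_bend i a : mink (a *m E z) (gam i - u i) =
  (C - 1) * dot a (row i t).
Proof. by rewrite minkDr minkNr mink_frame_gam EE mulrBl mul1r. Qed.

Lemma mink_bend i : mink (gam i - u i) (gam i - u i) = 2 - 2 * C.
Proof.
rewrite minkDl minkNl mink_frame_bend tt minkDr minkNr mink_gam.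
by rewrite (minkC (gam i)) mink_frame_gam tt; ring.
Qed.

Lemma geodesic_transport_isometry i a b :
  mink (geodesic_transport i a) (geodesic_transport i b) = dot a b.
Proof.
rewrite /geodesic_transport; have h1 := mink_frame_bend i; have h2 :=
  mink_bend i.
move: (gam i - u i) h1 h2 => G h1 h2.
rewrite minkDl !minkDr !minkZl !minkZr EE (minkC G) !h1 h2.
by ring.
Qed.

Lemma target_coord_isometry Y Y' :
  pow_form (@mink R n) (target_coord Y) (target_coord Y') =
  \sum_i dot (row i Y) (row i Y').
Proof. by apply: eq_bigr => i _; rewrite !rowK geodesic_transport_isometry. Qed.

Lemma point_hyperbolic i : hyperbolic k (x i).
Proof.
have := hyperbola_hyperbolic (k := k) (r := r) (v := r *: u i) k0 r0 hz.
rewrite minkZr zE mulr0 minkZl minkZr EE tt mulr1 => /(_ erefl erefl 1).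
rewrite /hyperbola mulr1 scalerA; congr (hyperbolic _ (_ + _ *: _)).
rewrite /s /S; field.
by rewrite k1 gt_eqF.
Qed.

(** Surjectivity is solved by hand: for w = l z + b E tangent at x_i,
orthogonality to x_i determines l, and the component of b along t_i has to be
divided by C. *)
Lemma target_coordP V : tangent (pow_set (m := n.+1) (@hyperbolic R k n))
    (change_var k E p) V <-> exists Y, V = target_coord Y.
Proof.
have tg i w : tangent (@hyperbolic R k n) (x i) w <-> mink (x i) w = 0.
  exact: tangent_hyperbolicP (point_hyperbolic i).
have zgam i : mink z (gam i) = - (S / k).
  by rewrite /gam minkDr !minkZr zE zz mulr0 addr0; field.
split=> [/tangent_pow tV|[Y ->]]; last first.
  apply/tangent_pow => i; rewrite row_change_var rowK; apply/tg.
  have hz' : mink z (gam i - u i) = - (S / k).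
    by rewrite minkDr minkNr zgam zE subr0.
  rewrite /x /geodesic_transport; have h1 := mink_frame_bend i.
  move: (gam i - u i) hz' h1 => G hz' h1.
  rewrite minkDl !minkDr !minkZl !minkZr hz' zE EE h1 tt (dotC (row i t)).
  by rewrite /s; ring.
suff /choice[y hy] : forall i, exists y, row i V = geodesic_transport i y.
  exists (\matrix_i y i); apply/row_matrixP => i.
  by rewrite !rowK hy.
move=> i; have := tV i; rewrite row_change_var => /tg.
have [l [b ->]] := frame_decomposition (row i V) hz.
rewrite /x minkDl !minkDr !minkZl !minkZr zz zE Ez EE !mulr0 add0r addr0
  dotC => e; pose d := dot b (row i t).
(* The component of b along t_i becomes d / C, as transport multiplies the
component along u_i by C. *)
exists (b + (- ((C - 1) / C * d)) *: row i t).
rewrite /geodesic_transport dotDl dotZl tt -/d mulmxDl -scalemxAl.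
have dC : d + - ((C - 1) / C * d) * 1 = d / C by field.
have -> : l = k * S / C * d.
  move: e; rewrite -/d /s => e.
  apply: (mulIf (_ : C * k ^- 2 != 0)); last first.
    have -> : l * (C * k ^- 2) = S / k * d by move: e; lra.
    by field; rewrite C0 k1.
  by rewrite mulf_neq0// invr_eq0 expf_neq0.
rewrite dC /gam /u; move: (row i t *m E z) (b *m E z) => U B.
by apply/rowP => j; rewrite !mxE; field.
Qed.

Lemma is_derive_frame (v : 'rV[R]_n.+1) (c : R -> 'rV[R]_n.+1) :
  c 0 = z -> is_derive (0:R) 1 c v ->
  is_derive (0:R) 1 (fun s => E (c s)) ('d E z v).
Proof.
move=> c0 dc; rewrite -c0; apply: is_derive_comp_diff => //.
by rewrite c0; have [] := hE hz.
Qed.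

(** Obtained by differentiating mink (b *m E c) c = 0 along a curve c of
velocity v. The frame is only constrained on the hyperboloid, so the argument
needs a curve that stays on it. *)
Lemma derive_frame_normal v b : mink z v = 0 ->
  mink (b *m 'd E z v) z = - mink (b *m E z) v.
Proof.
move/(tangent_hyperbolicP _ k0 hz) => [c [hc c0 dc]].
have h := is_derive_mink
  (is_derive_mulmx (is_derive_const b 0) (is_derive_frame c0 dc)) dc.
have e : \forall s \near (0:R), mink (b *m E (c s)) (c s) = 0.
  by apply: filterS hc => q hs; exact: frame_normal.
have := near_const_derive h e; rewrite mul0mx add0r c0 => /eqP.
by rewrite addr_eq0 => /eqP.
Qed.

(** Differentiates the constancy of the norm of b *m E c along a curve: the
tangential part of the derivative of an orthonormal frame is skew-symmetric. *)
Lemma derive_frame_skew v b : mink z v = 0 ->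
  mink (b *m 'd E z v) (b *m E z) = 0.
Proof.
move/(tangent_hyperbolicP _ k0 hz) => [c [hc c0 dc]].
have h1 := is_derive_mulmx (is_derive_const b 0) (is_derive_frame c0 dc).
have h := is_derive_mink h1 h1.
have e : \forall s \near (0:R), mink (b *m E (c s)) (b *m E (c s)) = dot b b.
  by apply: filterS hc => q hs; exact: frame_isometry.
have := near_const_derive h e; rewrite mul0mx add0r c0 (minkC (b *m E z)) => e'.
lra.
Qed.

(** The i-th row of the differential of the change of variables at (r, z, t),
the derivative of cosh (k r) z + sinh (k r) / k (t_i *m E z). *)
Definition image_velocity (v : source_type R n) i : 'rV[R]_n.+1 :=
  (k * S * v.1.1) *: z + C *: v.1.2 + (C * v.1.1) *: u i
  + s *: (row i v.2 *m E z + row i t *m 'd E z v.1.2).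

Lemma is_derive_change_var (v : source_type R n) c :
  curve_at (source k (n := n)) p v c ->
  is_derive (0:R) 1 (change_var k E \o c) (\matrix_i image_velocity v i).
Proof.
move=> [hc c0 dc].
have dr := is_derive_fst (is_derive_fst dc).
have dz := is_derive_snd (is_derive_fst dc).
have dt := is_derive_snd dc.
have cr : (c 0).1.1 = r by rewrite c0.
have cz : (c 0).1.2 = z by rewrite c0.
have ct : (c 0).2 = t by rewrite c0.
have dE := is_derive_frame cz dz.
pose G (s : R) : 'M[R]_n.+1 := \matrix_i (cosh (k * (c s).1.1) *: (c s).1.2 +
    (sinh (k * (c s).1.1) / k) *: (row i (c s).2 *m E (c s).1.2)).
apply: (near_eq_is_derive (f := G)).
  apply: filterS hc => q hs; apply/row_matrixP => i.
  by rewrite rowK /= change_varE.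
apply: is_derive_rows => i; rewrite rowK.
under eq_fun do rewrite rowK.
have dcosh := is_derive1_comp (f := fun x => cosh (k * x)) (is_derive_cosh k _)
  dr.
have dsinh := is_derive_mul (is_derive1_comp (f := fun x => sinh (k * x))
  (is_derive_sinh k _) dr)
  (is_derive_const (k^-1 : R) 0).
have h := is_derive_add (is_derive_scale dcosh dz)
  (is_derive_scale dsinh (is_derive_mulmx (is_derive_row i dt) dE)).
refine (is_derive_eq h _); rewrite /= cr cz ct.
rewrite /image_velocity /u -/C -/S -/s.
rewrite mulr0 addr0 !addrA; congr (_ + _ + _ *: _ + _).
by field.
Qed.

(** The coordinates of the differential in the orthonormal basis of the tangent
space at x_i that parallel transport makes of the frame at z. *)
Definition image_coord (Y : 'M[R]_(n.+1, n)) : 'M[R]_(n.+1, n) :=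
  \matrix_(i, j) mink (image_velocity (source_coord Y) i)
    (geodesic_transport i (delta_mx 0 j)).

(** The differential is tangent to the hyperboloids, so that it is recovered
from its coordinates in the orthonormal bases of their tangent spaces. *)
Lemma image_coordP Y :
  \matrix_i image_velocity (source_coord Y) i = target_coord (image_coord Y).
Proof.
have tg i w : tangent (@hyperbolic R k n) (x i) w <-> mink (x i) w = 0.
  exact: tangent_hyperbolicP (point_hyperbolic i).
have /target_coordP[Y' hY'] : tangent (pow_set (m := n.+1) (@hyperbolic R k n))
    (change_var k E p) (\matrix_i image_velocity (source_coord Y) i).
  apply/tangent_pow => i; rewrite row_change_var rowK; apply/tg.
  rewrite /image_velocity /= /x.
  set a := \row__ _; set m := \matrix_(_, _) _.
  have mt : dot (row i t) (row i m) = 0.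
    have /= -> := row_tangential Y i.
    by rewrite dotDr dotZr tt mxE mulr1 dotC subrr.
  have h1 := derive_frame_normal (row i t) (zE a).
  have h2 := derive_frame_skew (row i t) (zE a).
  move: ('d E z _) h1 h2 => G; rewrite minkC => h1; rewrite minkC => h2.
  rewrite EE in h1.
  rewrite minkDl !minkDr !minkZl !minkZr !minkDr zz !zE !Ez !EE tt mt h1 h2.
  by rewrite /s; field.
rewrite hY'; congr target_coord; apply/matrixP => i j; rewrite mxE.
have -> : image_velocity (source_coord Y) i = geodesic_transport i (row i Y').
  by have := congr1 (row i) hY'; rewrite !rowK.
by rewrite geodesic_transport_isometry dot_delta mxE.
Qed.

(** The part of the differential that depends on Y through its radial
components b alone, once s times the frame image of Y_i is set apart. It
contains the correction - s b_i u_i for the radial component of Y_i, which does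
not move t_i on the sphere. *)
Definition radial_image (b : 'rV[R]_n.+1) i : 'rV[R]_n.+1 :=
  let a := (\row_j b 0 (lift ord0 j)) *m E z in
  (k * S * b 0 ord0) *: z + C *: a + (C * b 0 ord0 - s * b 0 i) *: u i
  + s *: (row i t *m 'd E z a).

(** The coordinates of [radial_image], together with the defect s (C - 1) b_i
t_i of the transport of Y_i. *)
Definition radial_coord (b : 'rV[R]_n.+1) : 'M[R]_(n.+1, n) :=
  \matrix_(i, j) (mink (radial_image b i) (geodesic_transport i (delta_mx 0 j))
     + s * (C - 1) * b 0 i * t i j).

(** In coordinates the differential is a scalar plus a map that factors through
the n.+1 radial components. *)
Lemma image_coordE Y : image_coord Y = s *: Y + radial_coord (radial Y).
Proof.
apply/matrixP => i j; rewrite mxE [RHS]mxE [(s *: Y) i j]mxE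
  [radial_coord _ i j]mxE.
have -> : image_velocity (source_coord Y) i =
  s *: (row i Y *m E z) + radial_image (radial Y) i.
  rewrite /image_velocity row_tangential /radial_image /=.
  rewrite mulmxDl -scalemxAl -/(u i).
  set d := 'd E z _; move: (row i t *m d) => G.
  move: (_ *m E z) (u i) => A U.
  by apply/rowP => l; rewrite ![in LHS]mxE ![in RHS]mxE; ring.
have -> : mink (s *: (row i Y *m E z) + radial_image (radial Y) i)
    (geodesic_transport i (delta_mx 0 j)) = s * mink (row i Y *m E z)
    (geodesic_transport i (delta_mx 0 j)) + mink (radial_image (radial Y) i)
    (geodesic_transport i (delta_mx 0 j)) by rewrite minkDl minkZl.
have -> : mink (row i Y *m E z) (geodesic_transport i (delta_mx 0 j)) =
    Y i j + t i j * ((C - 1) * radial Y 0 i).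
  rewrite /geodesic_transport minkDr EE dot_delta minkZr mink_frame_bend.
  by rewrite dotC dot_delta !mxE.
by ring.
Qed.

(** The only information on the perturbation that enters the determinant. The
variations of r and of z move x_i along its geodesic by b_0 and a . t_i, the
latter as C^2 - S^2 times a . t_i: the factor C^2 comes from the translation of
z, and - S^2 from the rotation of the frame towards z. Hence the pairing of b
with the row (1, t_i). *)
Lemma radial_radial_coord b :
  radial (radial_coord b) = b *m (row_mx (const_mx 1 : 'cV_n.+1) t :
    'M[R]_n.+1)^T - s *: b.
Proof.
apply/rowP => i; pose a := \row_j b 0 (lift ord0 j).
transitivity (b 0 ord0 + dot a (row i t) - s * b 0 i); last first.
  set T := _^T; transitivity ((b *m T) 0 i - s * b 0 i); last by rewrite !mxE.
  congr (_ - _); rewrite [RHS]mxE [RHS]big_ord_recl {}/T; congr (_ + _).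
    rewrite mxE; have -> : ord0 = lshift n (ord0 : 'I_1) :> 'I_(1 + n)
      by apply/val_inj.
    by rewrite (@row_mxEl _ _ 1 n) mxE mulr1.
  apply: eq_bigr => j _; rewrite mxE [row i t 0 j]mxE [in RHS]mxE;
    congr (_ * _).
  have -> : lift ord0 j = rshift 1 j by apply/val_inj.
  exact/esym/(@row_mxEr _ _ 1 n).
have -> : radial (radial_coord b) 0 i =
    mink (radial_image b i) (gam i) + s * (C - 1) * b 0 i.
  have -> : gam i = geodesic_transport i (row i t).
    by rewrite /geodesic_transport tt scale1r addrC subrK.
  rewrite (linear_delta _ (geodesic_transport_linear i)) minkC mink_suml.
  have e : s * (C - 1) * b 0 i = \sum_j s * (C - 1) * b 0 i * t i j * t i j.
    rewrite -[LHS]mulr1 -(tt i) mulr_sumr; apply: eq_bigr => j _.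
    by rewrite !mxE mulrA.
  rewrite e -big_split mxE; apply: eq_bigr => j _.
  by rewrite minkZl (minkC _ (radial_image b i)) !mxE mulrDl
    [_ * t i j in LHS]mulrC.
have h1 := derive_frame_normal (row i t) (zE a).
have h2 := derive_frame_skew (row i t) (zE a).
have -> : radial_image b i = b 0 ord0 *: gam i + C *: (a *m E z) -
    (s * b 0 i) *: u i + s *: (row i t *m 'd E z (a *m E z)).
  rewrite /radial_image -/a /gam.
  congr (_ + _); move: (_ *m E z) (u i) => A U.
  by apply/rowP => l; rewrite ![in LHS]mxE ![in RHS]mxE; ring.
have h3 : mink (row i t *m 'd E z (a *m E z)) (gam i) = -
  (k * S * dot a (row i t)).
  by rewrite /gam minkDr !minkZr h1 h2 EE mulr0 addr0 dotC mulrN.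
rewrite !(minkDl _ _ (gam i)) (minkNl _ (gam i)) !(minkZl _ _ (gam i)).
rewrite h3 mink_gam !mink_frame_gam tt.
have -> : s = S / k by [].
transitivity (b 0 ord0 + (C ^+ 2 - S ^+ 2) * dot a (row i t) - S / k * b 0 i).
  by field.
by rewrite CS mul1r.
Qed.

Lemma radial_coord_linear : linear radial_coord.
Proof.
move=> c b b'; apply/matrixP => i j.
rewrite mxE [RHS]mxE [(c *: radial_coord b) i j]mxE [radial_coord b i j]mxE
  [radial_coord b' i j]mxE.
have -> : radial_image (c *: b + b') i =
  c *: radial_image b i + radial_image b' i.
  rewrite /radial_image.
  have -> : \row_j (c *: b + b') 0 (lift ord0 j) =
      c *: (\row_j b 0 (lift ord0 j)) + \row_j b' 0 (lift ord0 j).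
    by apply/rowP => l; rewrite !mxE.
  rewrite mulmxDl -scalemxAl (linearP ('d E z)) mulmxDr -scalemxAr.
  move: ('d E z _) ('d E z _) => G G'.
  move: (_ *m G) (_ *m G') (_ *m E z) (_ *m E z) (u i) => H H' A A' U.
  by apply/rowP => l; rewrite !mxE; ring.
rewrite (minkDl _ _ (geodesic_transport _ _))
  (minkZl _ _ (geodesic_transport _ _)).
rewrite [(c *: b + b') 0 i]mxE [(c *: b) 0 i]mxE.
by ring.
Qed.

Lemma frame_inj (a b : 'rV[R]_n) : a *m E z = b *m E z -> a = b.
Proof. by move=> ab; apply/rowP => j; rewrite -!dot_delta -!EE ab. Qed.

Lemma simplex_vol_frame : simplex_vol (E z) (t *m E z) =
  lebesgue_rV (simplex t).
Proof.
have e (a : 'I_n.+1 -> R) :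
    \sum_i a i *: row i (t *m E z) = (\sum_i a i *: row i t) *m E z.
  rewrite mulmx_suml; apply: eq_bigr => i _.
  by rewrite row_mul scalemxAl.
congr lebesgue_rV; apply/seteqP; split=> y [a [a0 a1 h]]; exists a; split=> //.
  by apply: frame_inj; rewrite h e.
by rewrite h e.
Qed.

(** The determinant is kept here as a quotient of powers of s, as it comes out
of Sylvester's identity with the exponents n (n + 1) and n + 1. *)
Lemma jacobian_change_var :
  let is_J := is_jacobian_det (n * n.+1)
    (@source_form R n) (source k (n := n))
    (pow_form (@mink R n)) (pow_set (@hyperbolic R k n))
    (change_var k E) p in
  let J0 := s ^+ (n * n.+1) / s ^+ n.+1 *
    \det (row_mx (const_mx 1 : 'cV_n.+1) t : 'M[R]_n.+1) in
  is_J J0 /\ forall J, is_J J -> `|J| = `|J0|.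
Proof.
pose T := (row_mx (const_mx 1 : 'cV_n.+1) t : 'M[R]_n.+1)^T.
pose B : 'M[R]_(n * n.+1, n.+1) := \matrix_i (radial \o @unvec R n.+1 n)
  (delta_mx 0 i).
pose U : 'M[R]_(n.+1, n * n.+1) := \matrix_i (@vec R n.+1 n \o radial_coord)
  (delta_mx 0 i).
have BE y : y *m B = radial (unvec y).
  by apply: (mul_delta_images (f := radial \o @unvec R n.+1 n));
    apply: comp_linear; [exact: radial_linear|exact: unvec_linear].
have UE y : y *m U = vec (radial_coord y).
  by apply: (mul_delta_images (f := @vec R n.+1 n \o radial_coord));
    apply: comp_linear; [exact: vec_linear|exact: radial_coord_linear].
pose L := s%:M + B *m U.
have LE y : unvec (y *m L) = image_coord (unvec y).
  rewrite mulmxDr mul_mx_scalar mulmxA BE UE unvec_linear vecK.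
  by rewrite image_coordE.
(* The small matrix of Sylvester's identity is the transpose of (1 | t). *)
have UB : s%:M + U *m B = T.
  apply/row_matrixP => i; rewrite !rowE mulmxDr mul_mx_scalar mulmxA UE BE vecK.
  by rewrite radial_radial_coord addrC subrK.
have s0 : s != 0 by rewrite mulf_neq0 ?invr_eq0// gt_eqF// sinh_gt0// mulr_gt0.
have detL : \det L = s ^+ (n * n.+1) / s ^+ n.+1 *
    \det (row_mx (const_mx 1 : 'cV_n.+1) t : 'M[R]_n.+1).
  have := det_scalar_addM s B U; rewrite -/L UB det_tr => e.
  apply: (mulfI (_ : s ^+ n.+1 != 0)); first by rewrite expf_neq0.
  by rewrite e mulrA mulrCA divff ?expf_neq0// mulr1.
move=> is_J J0; rewrite /is_J /J0 -detL.
apply: (@jacobian_coordinates _ _ _ _ _ _ _ _ _ _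
  (source_coord \o @unvec R n.+1 n) (target_coord \o @unvec R n.+1 n) L).
- by apply: comp_linear; [exact: source_coord_linear|exact: unvec_linear].
- by apply: comp_linear; [exact: target_coord_linear|exact: unvec_linear].
- move=> v; split=> [/source_coordP[Y ->]|[y ->]].
    by exists (vec Y); rewrite /= vecK.
  by apply/source_coordP; exists (unvec y).
- move=> v; split=> [/target_coordP[Y ->]|[y ->]].
    by exists (vec Y); rewrite /= vecK.
  by apply/target_coordP; exists (unvec y).
- by move=> y y' /=; rewrite source_coord_isometry dot_unvec.
- by move=> y y' /=; rewrite target_coord_isometry dot_unvec.
- move=> y c hc; rewrite /= LE -image_coordP.
  exact: is_derive_change_var.
Qed.

End change_of_variables.

Theorem proposition1p1 (R : realType) (k : R) (n : nat)
    (k_gt0 : 0 < k) (n_ge1 : (1 <= n)%N)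
    (E : 'rV[R]_n.+1 -> 'M[R]_(n, n.+1)) (hE : is_orthonormal_frame k E)
    (r : R) (z : 'rV[R]_n.+1) (t : 'M[R]_(n.+1, n))
    (r_gt0 : 0 < r) (hz : hyperbolic k z)
    (ht : forall i, unit_sphere (row i t)) :
  let u := t *m E z in
  let is_J := is_jacobian_det (n * n.+1)
    (@source_form R n) (@source R k n)
    (pow_form (@mink R n)) (pow_set (@hyperbolic R k n))
    (change_var k E) (r, z, t) in
  (exists J : R, is_J J) /\
  forall J : R, is_J J ->
    (`|J|%:E = (n`!)%:R%:E * simplex_vol (E z) u
               * ((sinh (k * r) / k) ^+ (n ^ 2 - 1))%:E)%E.
Proof.
move=> u is_J.
have [hJ J_unique] := jacobian_change_var k_gt0 hE r_gt0 hz ht.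
split; first by eexists; exact: hJ.
move=> J /J_unique ->.
have s_gt0 : 0 < sinh (k * r) / k by rewrite divr_gt0// sinh_gt0// mulr_gt0.
have -> : (n * n.+1 = n ^ 2 - 1 + n.+1)%N.
  by rewrite mulnS addnC -mulnn addnS -addSn subn1 prednK// muln_gt0 n_ge1.
rewrite exprD mulfK ?expf_neq0 ?gt_eqF// normrM EFinM.
rewrite (ger0_norm (exprn_ge0 _ (ltW s_gt0))).
rewrite (simplex_vol_frame hE)// lebesgue_simplex muleC.
by [].
Qed.
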